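(* Let $X\subset\mathbb{R}^d$ be compact and let $f\in\mathrm{PAff}(X;X)$ be a non-degenerate piecewise affine map. Then $$H_{\mathrm{mult}}(f)\le\sum_{i=1}^{d-1}\rho_i(f).$$
   Context: **Piecewise affine maps.** A piecewise affine map $(X,\mathcal Z,f)$, written $f\in\mathrm{PAff}(X;X)$, consists of a compact set $X\subset\mathbb{R}^d$, a finite collection $\mathcal Z$ of open, pairwise disjoint polytopes such that $X'=\bigcup_{Z\in\mathcal Z}Z$ is dense in $X$, and a map $f:X'\to X$ such that $f_Z:=f|_Z:Z\to X$ is affine for each $Z\in\mathcal Z$. The $f_Z$ are the affine components of $f$; the linear part of $f_Z$ is $f_Z'$, and $d_xf:=f_Z'$ for $x\in Z$. $f$ is non-degenerate if every $f_Z'$ is invertible. Put $U_n=\bigcap_{k=0}^{n-1}f^{-k}(X')$, the set of points where $f^n$ is defined; for $x\in U_n$, $d_xf^n$ is the corresponding product of linear parts along the orbit. $\mathcal Z^n$ denotes the continuity partition of $f^n$: the collection of all nonempty sets $Z_0\cap f^{-1}(Z_1)\cap\dots\cap f^{-(n-1)}(Z_{n-1})$ with $Z_i\in\mathcal Z$. **Multiplicity entropy.** For $a\in X$, $\mathrm{mult}(\mathcal Z^n,a)=|\{Z\in\mathcal Z^n: a\in\bar Z\}|$, $\mathrm{mult}(\mathcal Z^n)=\sup_{a\in X}\mathrm{mult}(\mathcal Z^n,a)$, and $H_{\mathrm{mult}}(f)=\limsup_{n\to\infty}\frac1n\log\mathrm{mult}(\mathcal Z^n)$. **Angular expansion rates.**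 For non-degenerate $f$ and $x\in U_n$, the spherization is $d_x^{(s)}f^n:S^{d-1}\to S^{d-1}$, $d_x^{(s)}f^n(v)=\dfrac{d_xf^n(v)}{\|d_xf^n(v)\|}$ (Euclidean norm). Let $d_vd_x^{(s)}f^n$ denote the differential of this map at $v\in S^{d-1}$. For $0\le i<d$, $$\rho_i(f)=\limsup_{n\to\infty}\frac1n\sup_{x\in U_n}\max_{0\le k\le i}\sup_{v\in S^{d-1}}\log\|\Lambda^kd_vd_x^{(s)}f^n\|,$$ where $\Lambda^k$ is the $k$-th exterior power (with $\|\Lambda^0\|=1$). *)

(* Defs.v *)
From mathcomp Require Import all_boot all_order all_algebra.
From mathcomp Require Import finmap.
From mathcomp Require Import all_classical all_reals all_analysis.

Set Implicit Arguments.
Unset Strict Implicit.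
Unset Printing Implicit Defensive.

Import Order.TTheory GRing.Theory Num.Theory.
Import numFieldNormedType.Exports.

Local Open Scope classical_set_scope.
Local Open Scope ring_scope.

(* Conventions.  R^d is ['rV[R]_d]: vectors are rows and a linear map of     *)
(* matrix [A] is [v |-> v *m A], so composites are products read from left   *)
(* to right.  The library norm of ['rV[R]_d] is the sup norm; it only        *)
(* supplies the topology, metric quantities use [enorm].                     *)

Section Euclidean.
Context {R : realType} {d : nat}.
Implicit Types u v : 'rV[R]_d.

Definition dotv u v : R := \sum_i u 0 i * v 0 i.

Definition enorm v : R := Num.sqrt (dotv v v).

Definition sphere : set 'rV[R]_d := [set v | enorm v = 1].

Definition tangent v : set 'rV[R]_d := [set u | dotv u v = 0].

(* Polytopes are convex. *)
Definition open_polytope (Z : set 'rV[R]_d) : Prop :=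
  bounded_set Z /\
  exists (m : nat) (a : 'I_m -> 'rV[R]_d) (b : 'I_m -> R),
    (forall i, a i != 0) /\ Z = [set x | forall i, dotv (a i) x < b i].

End Euclidean.

(* Piecewise affine maps of [X].  [paff_fun] is total; only its values on        *)
(* [\bigcup_(Z in pcells) Z] are meaningful.  For a nonempty cell [Z] the    *)
(* matrix [plin Z] is determined by [paff_fun], since [Z] is open.               *)
Record paff (R : realType) (d : nat) (X : set 'rV[R]_d) := PAff {
  pcells : set (set 'rV[R]_d) ;
  paff_fun : 'rV[R]_d -> 'rV[R]_d ;
  plin : set 'rV[R]_d -> 'M[R]_d ;
  ptrans : set 'rV[R]_d -> 'rV[R]_d ;
  paff_compact : compact X ;
  pcells_finite : finite_set pcells ;
  pcells_polytope : forall Z, pcells Z -> open_polytope Z ;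
  pcells_disjoint : trivIset pcells id ;
  pcells_sub : \bigcup_(Z in pcells) Z `<=` X ;
  pcells_dense : X `<=` closure (\bigcup_(Z in pcells) Z) ;
  paff_fun_into : forall Z x, pcells Z -> Z x -> X (paff_fun x) ;
  paff_fun_affine : forall Z x, pcells Z -> Z x ->
    paff_fun x = x *m plin Z + ptrans Z
}.

Section Dynamics.
Context {R : realType} {d : nat} {X : set 'rV[R]_d}.
Variable f : paff X.

Definition regular_set : set 'rV[R]_d := \bigcup_(Z in pcells f) Z.

Definition paff_nondegenerate : Prop :=
  forall Z, pcells f Z -> plin f Z \in unitmx.

(* the cell containing [x], for [x] in [regular_set] *)
Definition cell_at (x : 'rV[R]_d) : set 'rV[R]_d :=
  xget set0 [set Z | pcells f Z /\ Z x].

Definition dpaff (x : 'rV[R]_d) : 'M[R]_d := plin f (cell_at x).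

Definition iter_domain (n : nat) : set 'rV[R]_d :=
  [set x | forall k, (k < n)%N -> regular_set (iter k (paff_fun f) x)].

Definition dpaffn (n : nat) (x : 'rV[R]_d) : 'M[R]_d :=
  \big[mulmx/1%:M]_(k < n) dpaff (iter k (paff_fun f) x).

Definition continuity_partition (n : nat) : set (set 'rV[R]_d) :=
  [set W | W !=set0 /\
    exists s : 'I_n -> set 'rV[R]_d,
      (forall k, pcells f (s k)) /\
      W = [set x | forall k : 'I_n, s k (iter k (paff_fun f) x)]].

(* The set counted here is finite, so [fset_set] gives its elements. *)
Definition mult_at (n : nat) (a : 'rV[R]_d) : nat :=
  #|` fset_set [set Z | continuity_partition n Z /\ closure Z a]|%fset.

Definition mult (n : nat) : \bar R :=
  ereal_sup [set (mult_at n a)%:R%:E | a in X].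

Definition Hmult : \bar R :=
  limn_esup (fun n => ((n%:R^-1)%:E * lne (mult n))%E).

End Dynamics.

(* Exterior powers.  [incidx k d] is the type of multi-indices               *)
(* I = (I_0 < ... < I_(k-1)) in {0, ..., d-1}; the k-th exterior power of    *)
(* R^d is [extp k d] = R^(incidx k d), the coordinates being taken on the    *)
(* basis e_I = e_(I_0) /\ ... /\ e_(I_(k-1)).  This basis is orthonormal for *)
(* the inner product <u_1 /\ ... /\ u_k, w_1 /\ ... /\ w_k> = det <u_i, w_j>. *)

Definition incidx (k d : nat) :=
  {I : {ffun 'I_k -> 'I_d} |
     [forall i : 'I_k, forall j : 'I_k, (i < j)%N ==> (I i < I j)%N]}.

Section ExteriorPower.
Context {R : realType}.
Variables (k d : nat).

Definition extp := {ffun incidx k d -> R}.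

(* u_1 /\ ... /\ u_k, where u_i is the i-th row of [U] *)
Definition wedge (U : 'M[R]_(k, d)) : extp :=
  [ffun J : incidx k d => \det (\matrix_(i < k, j < k) U i (val J j))].

(* linear extension of e_I |-> L e_(I_0) /\ ... /\ L e_(I_(k-1)) *)
Definition extpow (L : 'rV[R]_d -> 'rV[R]_d) (w : extp) : extp :=
  [ffun J : incidx k d =>
     \sum_(I : incidx k d)
        w I * wedge (\matrix_(i < k) L (delta_mx 0 (val I i))) J].

Definition enorm_ext (w : extp) : R := Num.sqrt (\sum_I w I ^+ 2).

(* The k-th exterior power of a subspace [T], inside that of R^d. *)
Definition extp_sub (T : set 'rV[R]_d) : set extp :=
  [set w | exists (m : nat) (c : 'I_m -> R) (U : 'I_m -> 'M[R]_(k, d)),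
     (forall l i, T (row i (U l))) /\
     forall J, w J = \sum_(l < m) c l * wedge (U l) J].

(* Operator norm of the k-th exterior power of [L] restricted to [T]. *)
Definition extpow_norm (T : set 'rV[R]_d) (L : 'rV[R]_d -> 'rV[R]_d) : \bar R :=
  ereal_sup [set (enorm_ext (extpow L w))%:E |
              w in [set w | extp_sub T w /\ enorm_ext w <= 1]].

End ExteriorPower.

Section AngularExpansion.
Context {R : realType} {d : nat}.

(* [spherization A] is homogeneous of degree 0 and, for [A] invertible,      *)
(* smooth off the origin.  On [sphere] it is the spherization of [A], whose  *)
(* differential at [v] is therefore the restriction to [tangent v] of the    *)
(* differential in R^d.                                                      *)
Definition spherization (A : 'M[R]_d) (v : 'rV[R]_d) : 'rV[R]_d :=
  (enorm (v *m A))^-1 *: (v *m A).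

Definition angular_norm (k : nat) (A : 'M[R]_d) (v : 'rV[R]_d) : \bar R :=
  extpow_norm k (tangent v) ('d (spherization A) v).

Definition rho {X : set 'rV[R]_d} (f : paff X) (i : nat) : \bar R :=
  limn_esup (fun n =>
    ((n%:R^-1)%:E *
     ereal_sup [set \big[maxe/-oo]_(0 <= k < i.+1)
                      ereal_sup [set lne (angular_norm k (dpaffn f n x) v)
                                | v in sphere]
               | x in iter_domain f n])%E).

End AngularExpansion.

(* Main.v *)
Require Import Defs.
From mathcomp Require Import all_boot all_order all_algebra all_fingroup.
From mathcomp Require Import finmap.
From mathcomp Require Import all_classical all_reals all_analysis.
From mathcomp Require Import ring lra zify.

(* Near a point [a] the cells of the partition of [f^n] are cones, and the affine components act on
   the spheres of directions by spherizations, so one counts the itineraries adjacent to a flag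
   (a; v_1, ..., v_j), that is, to the infinitesimal point [a + e v_1 + ... + e^j v_j].  A full flag
   is adjacent to at most one itinerary.  To pass from j + 1 to j vectors, cut the time into blocks
   of length N and the sphere of the next direction into pieces so small that (Lebesgue number) a
   piece meets no more blocks of length N than some flag of length j + 1.  The image of a piece under
   a block with linear part A is again covered by pieces, boundedly many (in terms of d) times the
   largest minor of the linearized action.  If the flags at the source and at the target are
   orthonormalized, A becomes a lower triangular T, the linearized action is the block of T beyond
   the index j divided by the pivot T_jj, and its minors of order k are bounded by the angular norm
   of A of order k <= d - 1 - j at a suitable v.  Hence the growth rate of the counts increases by at
   most rho_(d-1-j) at each step. *)

Set Implicit Arguments.
Unset Strict Implicit.
Unset Printing Implicit Defensive.

Import Order.TTheory GRing.Theory Num.Theory.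
Import numFieldNormedType.Exports.

Local Open Scope classical_set_scope.
Local Open Scope ring_scope.

(** * The Cauchy-Binet formula *)

(** The number of cubes of a given size needed to cover the image of such a cube under a linear map
    is comparable to the product of its singular values exceeding 1, hence to its largest minor of
    any order, the empty minor 1 included; this is why all orders up to [d - 1 - j] occur and why
    [rho] takes a maximum over [k]. Blocks are needed for two reasons. Each covering costs a
    constant factor [C], which adds only [log C / N] to the rate when paid once per block of length
    [N]. Moreover the radius of the pieces must be small with respect to all blocks of length [N],
    but it is then fixed for all times, because images are covered again by pieces of the same
    radius. All counts must be uniform in the base point and the flag, since both move along the
    orbit; this uniformity comes from the finiteness of the set of affine forms defining blocks of
    length [N] and from the compactness of the sphere. Orthonormal frames make the covering
    constants depend on [d] only. *)

Lemma incidx_lt k d (I : incidx k d) (i j : 'I_k) : (i < j)%N -> (val I i < val I j)%N.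
Proof. by move=> ij; case: I => I /= /forallP/(_ i)/forallP/(_ j)/implyP; apply. Qed.

Lemma incidx_inj k d (I : incidx k d) : injective (val I).
Proof.
move=> i j eij; have [ij|ji|/ord_inj//] := ltngtP i j.
  by have := incidx_lt I ij; rewrite eij ltnn.
by have := incidx_lt I ji; rewrite eij ltnn.
Qed.

Lemma incidx_codom_sorted k d (I : incidx k d) :
  sorted (fun a b : 'I_d => (a < b)%N) (codom (val I)).
Proof.
rewrite /codom /image_mem sorted_map.
have : sorted (fun a b : 'I_k => (a < b)%N) (enum 'I_k).
  by have := iota_ltn_sorted 0 k; rewrite -val_enum_ord sorted_map.
by apply: sub_sorted => i j /=; apply: incidx_lt.
Qed.

(** An increasing multi-index is the sorted enumeration of its image, so the common image determines
    it; injectivity then determines the permutation. *)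
Lemma incidx_perm_uniq k d (I J : incidx k d) (s t : 'S_k) :
  (forall i, val I (s i) = val J (t i)) -> (I, s) = (J, t).
Proof.
move=> E.
have EC : codom (val I) = codom (val J).
  apply: (@irr_sorted_eq _ (fun a b : 'I_d => (a < b)%N)).
  - by move=> a b c; apply: ltn_trans.
  - by move=> a; rewrite ltnn.
  - exact: incidx_codom_sorted.
  - exact: incidx_codom_sorted.
  move=> x; apply/codomP/codomP => -[i ->].
    by exists (t (s^-1%g i)); rewrite -E permKV.
  by exists (s (t^-1%g i)); rewrite E permKV.
have EIJ : I = J.
  apply/val_inj/ffunP => i; move/eq_in_map: EC => -> //.
  by rewrite mem_enum.
subst J; congr pair; apply/permP => i; apply: (@incidx_inj _ _ I).
exact: E.
Qed.

Lemma incidx_perm_ex k d (f : {ffun 'I_k -> 'I_d}) : injective f ->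
  exists (I : incidx k d) (s : 'S_k), forall i, f i = val I (s i).
Proof.
move=> fi.
have [k0|kp] := posnP k.
  subst k; have H : [forall i : 'I_0, forall j : 'I_0, (i < j)%N ==> (f i < f j)%N].
    by apply/forallP => -[].
  by exists (Sub f H : incidx 0 d), 1%g => -[].
pose r := fun a b : 'I_d => (a <= b)%N.
pose s := sort r (codom f).
have ss : size s = k by rewrite size_sort size_codom card_ord.
have us : uniq s by rewrite sort_uniq; apply/injectiveP.
have ltns i : (i < k)%N -> (i < size s)%N by rewrite ss.
have fs i : f i \in s by rewrite mem_sort codom_f.
pose x0 : 'I_d := f (Ordinal kp).
pose I := [ffun i : 'I_k => nth x0 s i].
have H : [forall i : 'I_k, forall j : 'I_k, (i < j)%N ==> (I i < I j)%N].
  apply/forallP => i; apply/forallP => j; apply/implyP => ij; rewrite !ffunE.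
  rewrite ltn_neqAle; apply/andP; split.
    apply/eqP => /val_inj/eqP; rewrite nth_uniq ?ltns//.
    by move: ij; rewrite ltn_neqAle => /andP[/negbTE ->].
  have st : sorted r s by apply: sort_sorted => a b; exact: leq_total.
  have tr : transitive r by move=> b a c; apply: leq_trans.
  have rr : reflexive r by move=> a; apply: leqnn.
  by apply: (sorted_leq_nth tr rr x0 st); rewrite ?inE ?ltns// ltnW.
have ix i : (index (f i) s < k)%N by rewrite -[X in (_ < X)%N]ss index_mem.
have si : injective (fun i => Ordinal (ix i)).
  move=> i j /(congr1 (fun z : 'I_k => nth x0 s z)) /=.
  by rewrite !nth_index// => /fi.
exists (Sub I H : incidx k d), (perm si) => i.
by rewrite permE /= ffunE /= nth_index.
Qed.

(** Multilinearity gives a sum over all maps [f]. A non-injective [f] yields a determinant with two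
    equal rows; the injective ones are grouped by image, and the permutations of one image assemble
    the minor of [X]. *)
Lemma Cauchy_Binet (R : comNzRingType) k d (X : 'M[R]_(k, d)) (Y : 'M[R]_(d, k)) :
  \det (X *m Y) = \sum_(I : incidx k d)
     \det (\matrix_(i < k, j < k) X i (val I j)) * \det (\matrix_(i < k, j < k) Y (val I i) j).
Proof.
transitivity (\sum_(f : {ffun 'I_k -> 'I_d})
    (\prod_i X i (f i)) * \det (\matrix_(i < k, j < k) Y (f i) j)).
  rewrite /determinant.
  under eq_bigr => s _.
    under eq_bigr => i _ do rewrite mxE.
    rewrite bigA_distr_bigA /=.
    rewrite big_distrr /=.
    under eq_bigr => f _ do rewrite big_split /=.
    over.
  rewrite exchange_big /=; apply: eq_bigr => f _.
  rewrite big_distrr /=; apply: eq_bigr => s _.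
  rewrite mulrCA; congr (_ * (_ * _)); apply: eq_bigr => i _; by rewrite mxE.
rewrite (bigID (fun f : {ffun 'I_k -> 'I_d} => injectiveb f)) /= [X in _ + X]big1 ?addr0; last first.
  move=> f /injectivePn[i [j ij fij]].
  rewrite (determinant_alternate ij) ?mulr0// => l.
  by rewrite !mxE fij.
pose h (p : incidx k d * 'S_k) := [ffun i => val p.1 (p.2 i)].
have hinj : injective h.
  move=> [I s] [J t] /ffunP E; apply: incidx_perm_uniq => i.
  by have := E i; rewrite !ffunE.
transitivity (\sum_(f in [set h p | p in [set: incidx k d * 'S_k]]%SET)
    (\prod_i X i (f i)) * \det (\matrix_(i < k, j < k) Y (f i) j)).
  apply: eq_bigl => f; apply/injectiveP/imsetP.
    move=> /incidx_perm_ex[I [s E]]; exists (I, s); rewrite ?inE//.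
    by apply/ffunP => i; rewrite ffunE E.
  move=> [[I s] _ ->] i j; rewrite !ffunE => /incidx_inj; exact: perm_inj.
rewrite big_imset /=; last by move=> ? ? _ _; apply: hinj.
rewrite (eq_bigl xpredT); last by move=> x; rewrite inE.
rewrite -(pair_bigA _ (fun I s => (\prod_i X i (h (I, s) i)) *
  \det (\matrix_(i < k, j < k) Y (h (I, s) i) j))) /=.
apply: eq_bigr => I _.
rewrite {2}/determinant big_distrl /=; apply: eq_bigr => s _.
have -> : (\matrix_(i < k, j < k) Y (h (I, s) i) j) =
   row_perm s (\matrix_(i < k, j < k) Y (val I i) j).
  by apply/matrixP => i j; rewrite !mxE ffunE.
rewrite row_permE det_mulmx det_perm mulrCA mulrA; congr (_ * _ * _).
by apply: eq_bigr => i _; rewrite !mxE ffunE.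
Qed.

(** The crude Leibniz bound is enough: constants depending only on the dimension do not affect
    exponential rates. *)
Lemma det_le_fact (R : realFieldType) k (M : 'M[R]_k) :
  (forall i j, `|M i j| <= 1) -> `|\det M| <= (k`!)%:R.
Proof.
move=> H; rewrite /determinant; apply: le_trans (ler_norm_sum _ _ _) _.
apply: (@le_trans _ _ (\sum_(s : 'S_k) 1)); last first.
  by rewrite sumr_const card_Sn.
apply: ler_sum => s _; rewrite normrM normrX normrN1 expr1n mul1r.
elim/big_ind: _ => //[|x y x1 y1]; first by rewrite normr1.
by rewrite normrM mulr_ile1.
Qed.

(** * Orthonormal frames *)

Section Frames.
Context {R : realType}.

Definition orthomx d (G : 'M[R]_d) : Prop := G *m G^T = 1%:M.

Lemma orthomxC d (G : 'M[R]_d) : orthomx G -> G^T *m G = 1%:M.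
Proof. by move=> /mulmx1C. Qed.

Lemma orthomx_tr d (G : 'M[R]_d) : orthomx G -> orthomx G^T.
Proof. by rewrite /orthomx trmxK => /mulmx1C. Qed.

Lemma orthomx_mul d (G H : 'M[R]_d) : orthomx G -> orthomx H -> orthomx (G *m H).
Proof. by rewrite /orthomx trmx_mul => gG hH; rewrite mulmxA -(mulmxA G) hH mulmx1. Qed.

Lemma orthomx_entry d (G : 'M[R]_d) i j : orthomx G -> `|G i j| <= 1.
Proof.
move=> /matrixP/(_ i i); rewrite !mxE eqxx [RHS]/= => E.
rewrite -(expr_le1 (n:=2))// -normrX ger0_norm ?sqr_ge0//.
rewrite -[leRHS]E (bigD1 j)//= !mxE -expr2 lerDl sumr_ge0// => l _.
by rewrite !mxE -expr2 sqr_ge0.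
Qed.

Lemma dotv_mx d (u w : 'rV[R]_d) : dotv u w = (u *m w^T) 0 0.
Proof. by rewrite mxE; apply: eq_bigr => i _; rewrite mxE. Qed.

Lemma dotv_orthomx d (G : 'M[R]_d) (u w : 'rV[R]_d) : orthomx G ->
  dotv (u *m G) (w *m G) = dotv u w.
Proof. by move=> oG; rewrite !dotv_mx trmx_mul mulmxA -(mulmxA u) oG mulmx1. Qed.

Lemma dotvZ d (a b : R) (u w : 'rV[R]_d) : dotv (a *: u) (b *: w) = a * b * dotv u w.
Proof. by rewrite /dotv mulr_sumr; apply: eq_bigr => i _; rewrite !mxE; ring. Qed.

Lemma dotv_delta d (i j : 'I_d) : dotv (delta_mx 0 i) (delta_mx 0 j : 'rV[R]_d) = (i == j)%:R.
Proof.
rewrite /dotv (bigD1 j)//= big1 ?addr0 ?mxE ?eqxx ?mulr1 /=; first by rewrite eq_sym.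
by move=> l lj; rewrite !mxE (negbTE lj) mulr0.
Qed.

Lemma dotvv_ge0 d (u : 'rV[R]_d) : 0 <= dotv u u.
Proof. by apply: sumr_ge0 => i _; rewrite -expr2 sqr_ge0. Qed.

Lemma dotvv_eq0 d (u : 'rV[R]_d) : dotv u u = 0 -> u = 0.
Proof.
move=> /psumr_eq0P H; apply/rowP => i; rewrite [RHS]mxE.
have /eqP : u 0 i * u 0 i = 0 by apply: H => // k _; rewrite -expr2 sqr_ge0.
by rewrite mulf_eq0 orbb => /eqP.
Qed.

(** The reflection in the hyperplane orthogonal to [e_j - p] exchanges [e_j] and [p], and fixes
    every [e_l] orthogonal to [e_j - p]. The last clause keeps the beginning of a flag unchanged in
    [reframe]. *)
Lemma householder d (p : 'rV[R]_d) (j : 'I_d) : dotv p p = 1 ->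
  exists H : 'M[R]_d, [/\ orthomx H, row j H = p &
    forall l, l != j -> p 0 l = 0 -> row l H = delta_mx 0 l].
Proof.
move=> p1.
pose u := delta_mx 0 j - p.
pose s := dotv u u.
have pE : p *m p^T = 1%:M.
  apply/matrixP => a b; rewrite !ord1 !mxE eqxx -p1; apply: eq_bigr => i _.
  by rewrite mxE.
have sE : u *m u^T = s%:M.
  apply/matrixP => a b; rewrite !ord1 mxE [RHS]mxE eqxx mulr1n; apply: eq_bigr => i _.
  by rewrite [_^T _ _]mxE.
have suE : s = 2 * u 0 j.
  have : dotv u u = 1 - 2 * p 0 j + dotv p p.
    rewrite /dotv (bigD1 j)//= [in RHS](bigD1 j)//= !mxE eqxx.
    rewrite (eq_bigr (fun i => p 0 i * p 0 i)); last first.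
      by move=> i ij; rewrite !mxE eqxx (negbTE ij) sub0r mulrNN.
    by rewrite /= eqxx mulr1n; ring.
  by rewrite /s => ->; rewrite p1 !mxE !eqxx /=; ring.
have [u0|u0] := eqVneq s 0.
  have uz : u = 0 by apply: dotvv_eq0.
  have jp : p = delta_mx 0 j by apply/esym/eqP; rewrite -subr_eq0; apply/eqP.
  exists 1%:M; split; first by rewrite /orthomx trmx1 mulmx1.
    by rewrite row1 jp.
  by move=> l _ _; rewrite row1.
pose H := 1%:M - (2 / s) *: (u^T *m u).
have rH l : row l H = delta_mx 0 l - (2 / s * u 0 l) *: u.
  apply/rowP => i; rewrite !mxE big_ord1 !mxE eqxx /= [l == i]eq_sym.
  by ring.
exists H; split.
- have HT : H^T = H.
    apply/matrixP => a b; rewrite !mxE big_ord1 [in RHS]big_ord1 !mxE [b == a]eq_sym.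
    by rewrite [X in _ - _ * X]mulrC.
  rewrite /orthomx HT /H.
  rewrite mulmxBr mulmxBl mulmxBl !mulmx1 !mul1mx -scalemxAl -scalemxAr scalerA.
  rewrite mulmxA -(mulmxA u^T) sE mul_mx_scalar -!scalemxAl scalerA.
  rewrite -scalerBl -addrA -opprD -scalerDl.
  rewrite [X in X *: _](_ : _ = 0) ?scale0r ?subr0//; by field.
- rewrite rH suE in u0 *.
  rewrite [X in X *: _](_ : _ = 1); first by rewrite scale1r /u opprB addrC subrK.
  have uj0 : u 0 j != 0 by apply: contraNneq u0 => ->; rewrite mulr0.
  by field.
- move=> l lj pl; rewrite rH.
  have -> : u 0 l = 0 by rewrite !mxE pl (negbTE lj) eqxx subrr.
  by rewrite mulr0 scale0r subr0.
Qed.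

Definition lower_tri d (T : 'M[R]_d) : Prop :=
  (forall i j : 'I_d, (i < j)%N -> T i j = 0) /\ (forall i, 0 < T i i).

(** The first row is reflected onto an axis and the remaining block is treated recursively. Applied
    to [G *m A], this re-orthonormalizes the image of a flag; the positive diagonal preserves the
    orientation of each new direction. *)
Lemma QR d (A : 'M[R]_d) : A \in unitmx ->
  exists T G : 'M[R]_d, [/\ lower_tri T, orthomx G & A = T *m G].
Proof.
elim: d A => [A _|d IH].
  by exists 1%:M, 1%:M; split; [split=> -[]//|apply/matrixP => -[]|apply/matrixP => -[]].
rewrite -[d.+1]/((1 + d)%N) => A uA.
pose a : 'rV[R]_(1 + d) := row 0 A.
have a0 : a != 0.
  apply: contraTneq uA => a0; rewrite unitmxE.
  rewrite (expand_det_row _ 0) big1 ?unitr0// => j _.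
  by have /rowP/(_ j) := a0; rewrite !mxE => ->; rewrite mul0r.
have aa : 0 < dotv a a.
  by rewrite lt_neqAle dotvv_ge0 andbT; apply: contraNneq a0 => /esym/dotvv_eq0 ->.
pose n := enorm a.
have n0 : 0 < n by rewrite sqrtr_gt0.
have nn : n * n = dotv a a by rewrite -expr2 sqr_sqrtr// ltW.
have [|H [oH Hj _]] := @householder _ (n^-1 *: a) (0 : 'I_(1 + d)).
  rewrite /dotv (eq_bigr (fun i => (n^-1 * n^-1) * (a 0 i * a 0 i))).
    by rewrite -big_distrr /= -/(dotv a a) -nn; field; rewrite gt_eqF.
  by move=> i _; rewrite !mxE; ring.
pose B : 'M[R]_(1 + d) := A *m H^T.
have AB : A = B *m H by rewrite /B -mulmxA orthomxC// mulmx1.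
have uB : B \in unitmx.
  by rewrite unitmx_mul uA /= unitmx_tr; have [] := mulmx1_unit oH.
have B0 : forall j, B 0 j = if j == 0 then n else 0.
  move=> j; have -> : B 0 j = (n *: (row 0 H *m H^T)) 0 j.
    rewrite Hj -scalemxAl scalerA divff ?gt_eqF// scale1r !mxE; apply: eq_bigr => i _.
    by rewrite !mxE.
  by rewrite -row_mul oH row1 !mxE eqxx /= eq_sym; case: eqP; rewrite ?mulr1 ?mulr0.
have Bur : ursubmx B = 0.
  apply/matrixP => i j; rewrite ord1 [LHS]mxE [LHS]mxE [RHS]mxE.
  by rewrite (_ : lshift d 0 = 0) ?B0//; apply/val_inj.
have Bul : ulsubmx B = n%:M.
  apply/matrixP => i j; rewrite !ord1 [LHS]mxE [LHS]mxE [RHS]mxE eqxx.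
  by rewrite (_ : lshift d 0 = 0) ?B0 ?eqxx//; apply/val_inj.
have BE : B = block_mx n%:M 0 (dlsubmx B) (drsubmx B) by rewrite -Bul -Bur submxK.
have udr : drsubmx B \in unitmx.
  move: uB; rewrite !unitmxE BE det_lblock !unitfE mulf_eq0 negb_or => /andP[_].
  by rewrite -BE.
have [T' [G' [[T'l T'd] oG' BT]]] := IH _ udr.
exists (block_mx n%:M 0 (dlsubmx B) T'), (block_mx 1%:M 0 0 G' *m H); split.
- split.
    move=> i j; case: (split_ordP i) => i' ->; case: (split_ordP j) => j' ->.
    + by rewrite !ord1 ltnn.
    + by rewrite block_mxEur mxE.
    + by rewrite /= => /ltn_trans/(_ (ltn_ord j')); rewrite ltnNge leq_addr.
    + by rewrite block_mxEdr /= ltn_add2l; apply: T'l.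
  move=> i; case: (split_ordP i) => i' ->.
    by rewrite block_mxEul !ord1 mxE eqxx.
  by rewrite block_mxEdr.
- apply: orthomx_mul => //; rewrite /orthomx tr_block_mx mulmx_block !trmx0 trmx1.
  by rewrite !mulmx0 !mul0mx !mulmx1 !addr0 add0r oG' -scalar_mx_block.
- rewrite mulmxA mulmx_block !mulmx0 !mulmx1 !mul0mx !addr0 add0r -BT -BE; exact: AB.
Qed.

Lemma lower_tri_unit d (T : 'M[R]_d) : lower_tri T -> T \in unitmx.
Proof.
move=> [Tl Td]; rewrite unitmxE det_trig.
  by rewrite unitfE; apply/prodf_neq0 => i _; rewrite gt_eqF.
by apply/is_trig_mxP => i j /Tl.
Qed.

(** The inverse of a lower triangular matrix is lower triangular, so [T_jj e_j T^-1] is supported up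
    to [j]. It gives the source direction that is mapped exactly onto the [j]-th vector of the
    target frame. *)
Lemma lower_tri_solve d (T : 'M[R]_d) (j : 'I_d) : lower_tri T ->
  exists c : 'rV[R]_d, [/\ forall l : 'I_d, (j < l)%N -> c 0 l = 0, c 0 j = 1 &
    c *m T = T j j *: delta_mx 0 j].
Proof.
move=> lT; have [Tl Td] := lT.
pose c : 'rV[R]_d := T j j *: (delta_mx 0 j *m invmx T).
have cT : c *m T = T j j *: delta_mx 0 j.
  by rewrite /c -scalemxAl mulmxKV// lower_tri_unit.
have cTl l : \sum_i c 0 i * T i l = if l == j then T j j else 0.
  have /rowP/(_ l) := cT; rewrite !mxE => ->; rewrite eqxx /= eq_sym.
  by case: eqP; rewrite ?mulr1 ?mulr0.
have cgt (l : 'I_d) : (j < l)%N -> c 0 l = 0.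
  move=> jl; apply/eqP/negPn/negP => cl0.
  case: (arg_maxnP (P := fun m => c 0 m != 0) (fun m : 'I_d => m : nat) cl0) => m cm0 mmax.
  have := cTl m; rewrite (bigD1 m)//= big1 ?addr0.
    rewrite (_ : m == j = false); last first.
      by apply/negbTE/eqP => mj; have := mmax _ cl0; rewrite mj /geq /= leqNgt jl.
    by move/eqP; rewrite mulf_eq0 (negbTE cm0) gt_eqF.
  move=> i im; have [mi|im'] := ltnP m i.
    have [->|ci] := eqVneq (c 0 i) 0; first by rewrite mul0r.
    by have := mmax _ ci; rewrite /geq /= leqNgt mi.
  by rewrite Tl ?mulr0// ltn_neqAle im'; rewrite -val_eqE in im; rewrite im.
exists c; split=> //.
have := cTl j; rewrite eqxx (bigD1 j)//= big1 ?addr0.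
  by rewrite -{2}[T j j]mul1r => /(mulIf _) ->//; rewrite gt_eqF.
move=> i ij; have [ji|ij'] := ltnP j i; first by rewrite cgt ?mul0r.
by rewrite Tl ?mulr0// ltn_neqAle ij'; rewrite -val_eqE in ij; rewrite ij.
Qed.

End Frames.

(** * Covering linear images of cubes *)

(** The bordered matrix is a block lower triangular matrix times a block upper triangular one that
    carries the Schur complement in its corner. *)
Lemma schur_minor (F : fieldType) d (L : 'M[F]_d) (p q : 'I_d) k (I J : 'I_k -> 'I_d) :
  L p q != 0 ->
  let ext (a : 'I_d) (K : 'I_k -> 'I_d) (i : 'I_(1 + k)) :=
    match fintype.split i with inl _ => a | inr i' => K i' end in
  L p q * \det (\matrix_(i < k, j < k) (L (I i) (J j) - L (I i) q * L p (J j) / L p q)) =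
  \det (\matrix_(i < (1 + k), j < (1 + k)) L (ext p I i) (ext q J j)).
Proof.
move=> Lpq ext.
have sl (i : 'I_1) : fintype.split (lshift k i) = inl i := unsplitK (inl i).
have sr (i : 'I_k) : fintype.split (rshift 1 i) = inr i := unsplitK (inr i).
set S := (X in _ * \det X).
pose c : 'M[F]_(k, 1) := \matrix_(i, j) L (I i) q.
pose r : 'M[F]_(1, k) := \matrix_(i, j) (L p (J j) / L p q).
have -> : \matrix_(i < (1 + k), j < (1 + k)) L (ext p I i) (ext q J j) =
    block_mx (L p q)%:M 0 c 1%:M *m block_mx 1%:M r 0 S.
  rewrite mulmx_block !mulmx0 !mul0mx !mulmx1 !mul1mx !addr0.
  apply/matrixP => i j; rewrite mxE /ext.
  case: (split_ordP i) => i' ->; case: (split_ordP j) => j' ->;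
    rewrite ?(block_mxEul, block_mxEur, block_mxEdl, block_mxEdr) ?sl ?sr.
  - by rewrite !ord1 mxE eqxx.
  - by rewrite mul_scalar_mx !mxE mulrC divfK.
  - by rewrite mxE.
  - by rewrite !mxE big_ord1 !mxE; ring.
by rewrite det_mulmx det_lblock det_ublock det_scalar1 !det1 mulr1 mul1r.
Qed.

Lemma grid_cover (R : realType) (a rho : R) : 0 <= a -> 0 < rho ->
  exists s : seq R, (size s)%:R <= 2 * (a / rho) + 3 /\
    forall x, `|x| <= a -> exists2 z, z \in s & `|x - z| <= rho.
Proof.
move=> a0 r0.
have ar0 : 0 <= a / rho by rewrite divr_ge0// ltW.
have /andP[Nl Nu] := truncn_itv ar0.
set N := (Num.truncn (a / rho)).+1 in Nu.
exists [seq (k%:R - N%:R) * rho | k <- iota 0 (2 * N + 1)]; split.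
  rewrite size_map size_iota natrD natrM.
  by move: Nl; rewrite /N -(natr1 (Num.truncn _)) => Nl; lra.
move=> x xa.
have xr : `|x / rho| < N%:R.
  rewrite normrM normfV (gtr0_norm r0); apply: le_lt_trans Nu.
  by rewrite ler_pM2r ?invr_gt0.
have /andP[x1 x2] : - N%:R < x / rho < N%:R by rewrite -ltr_norml.
have t0 : 0 <= x / rho + N%:R by lra.
have /andP[kl ku] := truncn_itv t0.
set k := Num.truncn _ in kl ku.
exists ((k%:R - N%:R) * rho).
  apply/mapP; exists k => //; rewrite mem_iota add0n addn1 ltnS /=.
  have : (k%:R : R) < (2 * N)%:R by rewrite natrM; lra.
  by rewrite ltr_nat => /ltnW.
rewrite -natr1 in ku.
have -> : x - (k%:R - N%:R) * rho = (x / rho + N%:R - k%:R) * rho.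
  by field; rewrite gt_eqF.
rewrite normrM (gtr0_norm r0) -[leRHS]mul1r ler_pM2r// ler_norml; apply/andP; split; lra.
Qed.

Lemma rV_norm_mulmx (R : realType) d (L : 'M[R]_d) (y : 'rV[R]_d) a b j : 0 <= a -> 0 <= b ->
  (forall i, `|y 0 i| <= a) -> (forall i, `|L i j| <= b) -> `|(y *m L) 0 j| <= d%:R * a * b.
Proof.
move=> a0 b0 ya Lb; rewrite mxE; apply: le_trans (ler_norm_sum _ _ _) _.
apply: (@le_trans _ _ (\sum_(i < d) (a * b))).
  by apply: ler_sum => i _; rewrite normrM ler_pM.
by rewrite sumr_const card_ord -[leLHS]mulr_natl mulrA.
Qed.

Lemma grid_coverV (R : realType) d (a : R) : 0 <= a ->
  exists2 C : R, 0 <= C & forall rho, 0 < rho -> exists2 s : seq 'rV[R]_d, (size s)%:R <= C &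
    forall x : 'rV[R]_d, (forall i, `|x 0 i| <= a * rho) ->
      exists2 z, z \in s & forall i, `|x 0 i - z 0 i| <= rho.
Proof.
move=> a0; have a3 : 0 <= 2 * a + 3 by lra.
exists ((2 * a + 3) ^+ d); first exact: exprn_ge0.
move=> rho r0; have [|s [ss sP]] := @grid_cover R (a * rho) rho _ r0.
  by rewrite mulr_ge0// ltW.
rewrite mulfK ?gt_eqF// in ss.
exists [seq \row_i s`_(f i) | f : {ffun 'I_d -> 'I_(size s)}].
  by rewrite size_image card_ffun !card_ord natrX lerXn2r// nnegrE.
move=> x xa.
have H i : exists n : 'I_(size s), `|x 0 i - s`_n| <= rho.
  have [z zs zP] := sP _ (xa i).
  have zi : (index z s < size s)%N by rewrite index_mem.
  by exists (Ordinal zi); rewrite /= nth_index.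
have [g gP] := choice H.
exists (\row_i s`_((finfun g) i)); first by apply/fintype.imageP; exists (finfun g).
by move=> i; rewrite mxE ffunE.
Qed.

(* Induction on the number of nonzero rows, eliminating an entry of maximal absolute value: passing
   to the Schur complement divides all minors by the pivot, which pays for a grid in the pivot
   coordinate. *)
Lemma cover_linear_image (R : realType) d m (kap : R) : 0 <= kap ->
  exists2 C : R, 0 <= C & forall (L : 'M[R]_d) (rows : {set 'I_d}) (E rho : R),
    (#|rows| <= m)%N -> (forall i j, i \notin rows -> L i j = 0) -> 0 < rho ->
    (forall k (I J : 'I_k -> 'I_d), (k <= m)%N ->
      `|\det (\matrix_(i < k, j < k) L (I i) (J j))| <= E) ->
    exists2 ps : seq 'rV[R]_d, (size ps)%:R <= C * E &
      forall y : 'rV[R]_d, (forall i, `|y 0 i| <= kap * rho) ->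
        exists2 p, p \in ps & forall i, `|(y *m L) 0 i - p 0 i| <= rho.
Proof.
elim: m kap => [|m IH] kap kap0.
  exists 1 => // L rows E rho; rewrite leqn0 cards_eq0 => /eqP -> L0 r0 HE.
  (* The empty minor equals 1. *)
  have E1 : 1 <= E.
    have := HE 0%N (fun i => match i with Ordinal _ h => False_rect _ (notF h) end)
                 (fun i => match i with Ordinal _ h => False_rect _ (notF h) end) isT.
    by rewrite det_mx00 normr1.
  exists [:: 0]; first by rewrite mul1r.
  move=> y _; exists 0; rewrite ?inE// => i.
  rewrite [X in _ - X]mxE subr0 mxE big1 ?normr0 ?ltW// => j _.
  by rewrite L0 ?mulr0 ?inE.
(* Half of the tolerance is reserved for the pivot coordinate, so relative to the remaining half the
   cube is twice as large. *)
have [C' C'0 HC'] := IH (2 * kap) (mulr_ge0 (ler0n R 2) kap0).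
have dk0 : 0 <= d%:R * kap by rewrite mulr_ge0.
have [C0 C00 HC0] := @grid_coverV R d (d%:R * kap) dk0.
exists (C0 + (4 * (d%:R * kap) + 3) * C').
  by rewrite addr_ge0// mulr_ge0//; lra.
move=> L rows E rho cr L0 r0 HE.
have E1 : 1 <= E.
  have := HE 0%N (fun i => match i with Ordinal _ h => False_rect _ (notF h) end)
                 (fun i => match i with Ordinal _ h => False_rect _ (notF h) end) isT.
  by rewrite det_mx00 normr1.
have E0 : 0 <= E by apply: le_trans E1.
(* If no entry exceeds 1, the image lies in a cube of radius [d * kap * rho] and one grid of bounded
   size suffices. Otherwise the pivot exceeds 1, so the additive 3 in the size of its grid is at
   most [3 * sg]. *)
have [/forallP small|] := boolP [forall ij : 'I_d * 'I_d, `|L ij.1 ij.2| <= 1].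
  have [s ss sP] := HC0 _ r0; exists s.
    apply: le_trans ss _; rewrite mulrDl -[leLHS]mulr1 -[leLHS]addr0 lerD//.
      exact: ler_wpM2l.
    by rewrite !mulr_ge0//; lra.
  move=> y yk; apply: sP => i.
  rewrite -[leRHS]mulr1 -(mulrA d%:R kap); apply: rV_norm_mulmx => //.
    by rewrite mulr_ge0// ltW.
  by move=> j; apply: (small (j, i)).
rewrite negb_forall => /existsP[ij0]; rewrite -ltNge => big.
pose i0 := [arg max_(i > ij0) `|L i.1 i.2|]%O.
have maxL i j : `|L i j| <= `|L i0.1 i0.2|.
  by rewrite /i0; case: arg_maxP => // ij _ /(_ (i, j) isT).
move: (i0) maxL => [p q] /= maxL {i0}.
have s1 : 1 < `|L p q| by apply: lt_le_trans big _.
have Lpq : L p q != 0 by rewrite -normr_gt0; apply: lt_trans s1.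
set sg := `|L p q| in maxL s1.
have s0 : 0 < sg by apply: lt_trans s1.
pose S : 'M[R]_d := \matrix_(i, j) (L i j - L i q * L p j / L p q).
have pr : p \in rows by apply: contraNT Lpq => /L0 ->.
have r20 : 0 < rho / 2 by rewrite divr_gt0.
have [] := HC' S (rows :\ p)%SET (E / sg) (rho / 2).
- by rewrite -ltnS; apply: leq_trans cr; rewrite [X in (_ < X)%N](cardsD1 p) pr.
- move=> i j; rewrite !inE negb_and negbK mxE => /orP[/eqP ->|/L0 H].
    by rewrite mulrAC divff// mul1r subrr.
  by rewrite !H !mul0r subrr.
- exact: r20.
- move=> k I J km; rewrite ler_pdivlMr// mulrC -normrM.
  rewrite (_ : \matrix_(i, j) _ =
     \matrix_(i < k, j < k) (L (I i) (J j) - L (I i) q * L p (J j) / L p q)); last first.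
    by apply/matrixP => i j; rewrite !mxE.
  by rewrite schur_minor//; apply: HE.
move=> ps' sps' ps'P.
have [|gs [sgs gsP]] := @grid_cover R (d%:R * kap * rho * sg) (rho / 2) _ r20.
  by rewrite !mulr_ge0// ltW.
(* A multiple of the pivot row fixes coordinate [q]; the rest is an image under the Schur
   complement, whose column [q] vanishes. The grid has [O(sg)] points and the recursive cover at
   most [C' * (E / sg)], so the pivot cancels. *)
exists [seq (z / L p q) *: row p L + p' | z <- gs, p' <- ps'].
  rewrite size_allpairs natrM.
  have gsle : (size gs)%:R <= (4 * (d%:R * kap) + 3) * sg.
    apply: le_trans sgs _.
    have -> : 2 * (d%:R * kap * rho * sg / (rho / 2)) = 4 * (d%:R * kap) * sg.
      by field; rewrite gt_eqF.
    by rewrite [leRHS]mulrDl lerD2l -[leLHS]mulr1 ler_pM2l// ltW.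
  apply: (@le_trans _ _ ((4 * (d%:R * kap) + 3) * sg * (C' * (E / sg)))).
    by apply: ler_pM.
  have -> : (4 * (d%:R * kap) + 3) * sg * (C' * (E / sg)) = (4 * (d%:R * kap) + 3) * C' * E.
    by field; rewrite gt_eqF.
  by rewrite ler_wpM2r// lerDr.
move=> y yk.
have [|z zgs zP] := gsP ((y *m L) 0 q).
  rewrite -[X in X * sg]mulrA; apply: rV_norm_mulmx => //; last exact: ltW.
  by rewrite mulr_ge0// ltW.
have [|p' p'ps p'P] := ps'P y.
  by move=> i; apply: le_trans (yk i) _; rewrite le_eqVlt; apply/orP; left; apply/eqP; field.
exists ((z / L p q) *: row p L + p'); first by apply: allpairs_f.
move=> i.
have -> : (y *m L) 0 i - ((z / L p q) *: row p L + p') 0 i =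
   ((y *m L) 0 q - z) * (L p i / L p q) + ((y *m S) 0 i - p' 0 i).
  have -> : (y *m S) 0 i = (y *m L) 0 i - (y *m L) 0 q * (L p i / L p q).
    rewrite !mxE big_distrl /= -sumrB; apply: eq_bigr => l _; rewrite !mxE; by ring.
  rewrite [(_ + p') 0 i]mxE [(_ *: row p L) 0 i]mxE [row p L 0 i]mxE; by field.
apply: le_trans (ler_normD _ _) _.
rewrite [leRHS](splitr rho) lerD// normrM -[leRHS]mulr1 ler_pM//.
by rewrite normrM normfV ler_pdivrMr// mul1r.
Qed.

(** * Minors and angular norms *)

Section AngularNorm.
Context {R : realType}.

Lemma is_diff_bigsum (V W : normedModType R) n (x : V) (f df : 'I_n -> V -> W) :
  (forall i, is_diff x (f i) (df i)) -> is_diff x (\sum_i f i) (\sum_i df i).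
Proof.
move=> H; elim/big_ind2: _ => //; first exact: is_diff_cst.
by move=> *; apply: is_diffD.
Qed.

Lemma is_diff_mulmx_coord d (A : 'M[R]_d) (x : 'rV[R]_d) j :
  is_diff x (fun v => (v *m A) 0 j : R) (fun v => (v *m A) 0 j : R).
Proof.
have E : (fun v : 'rV[R]_d => (v *m A) 0 j : R) =
         \sum_(i < d) (A i j *: (fun v : 'rV[R]_d => v 0 i : R)).
  apply/funext => v; rewrite fct_sumE mxE; apply: eq_bigr => i _.
  by rewrite mulrC.
rewrite E; apply: is_diff_bigsum => i; apply: is_diffZ.
have @f : {linear 'rV[R]_d -> R}.
  by exists (fun N : 'rV[R]_d => N 0 i); do 2![eexists]; do ?[constructor];
     rewrite ?mxE// => ? *; rewrite ?mxE//; move=> ?; rewrite !mxE.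
rewrite (_ : (fun _ => _) = f) //.
apply: DiffDef; first exact/linear_differentiable/coord_continuous.
by rewrite diff_lin//; exact: coord_continuous.
Qed.

Lemma is_diff_sqrt (r : R) : 0 < r ->
  is_diff r Num.sqrt (fun h => h * (2 * Num.sqrt r)^-1).
Proof.
move=> r0; have H := is_derive1_sqrt r0.
have dr : differentiable (Num.sqrt : R -> R) r by apply/derivable1_diffP.
apply: DiffDef => //; apply/funext => h.
by rewrite diff1E// derive1E derive_val.
Qed.

(** Differentiating [y / |y|] removes the radial component and divides by [|y|], here with
    [y = v *m A]. *)
Lemma diff_spherization d (A : 'M[R]_d) (v u : 'rV[R]_d) : 0 < dotv (v *m A) (v *m A) ->
  'd (spherization A) v u = (enorm (v *m A))^-1 *:
     (u *m A - (dotv (v *m A) (u *m A) / dotv (v *m A) (v *m A)) *: (v *m A)).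
Proof.
move=> s0; set s := dotv (v *m A) (v *m A) in s0 *.
pose N (w : 'rV[R]_d) : R := dotv (w *m A) (w *m A).
have dN : is_diff v N (fun w => 2 * dotv (v *m A) (w *m A)).
  have E : N = \sum_(j < d) ((fun w : 'rV[R]_d => (w *m A) 0 j : R) * (fun w => (w *m A) 0 j : R)).
    by apply/funext => w; rewrite fct_sumE.
  rewrite E; apply: is_diff_eq.
    by apply: is_diff_bigsum => j; apply: is_diffM; apply: is_diff_mulmx_coord.
  apply/funext => w; rewrite fct_sumE /dotv mulr_sumr; apply: eq_bigr => j _.
  by rewrite [LHS]/= [2]mulr2n mulrDl mul1r.
pose n (w : 'rV[R]_d) : R := enorm (w *m A).
have ns : n v * n v = s by rewrite -expr2 sqr_sqrtr// ltW.
have n0 : 0 < n v by rewrite sqrtr_gt0.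
have dn : is_diff v n (fun w => dotv (v *m A) (w *m A) / n v).
  apply: is_diff_eq.
    apply: (@is_diff_comp _ _ _ _ N _ Num.sqrt _ v dN); exact: is_diff_sqrt.
  apply/funext => w /=; have -> : Num.sqrt (N v) = n v by [].
  by field; rewrite gt_eqF.
have din : is_diff v (fun w => (n w)^-1) (fun w => - (dotv (v *m A) (w *m A) / n v ^+ 3)).
  have [dfn En] := dn.
  apply: DiffDef; first by apply: differentiableV => //; rewrite gt_eqF.
  rewrite diffV ?gt_eqF// En; apply/funext => w /=.
  by rewrite /GRing.scale /=; field; rewrite gt_eqF.
have dF : is_diff v (spherization A) (fun w => \sum_(j < d)
     ((n v)^-1 * (w *m A) 0 j - (v *m A) 0 j * (dotv (v *m A) (w *m A) / n v ^+ 3)) *: delta_mx 0 j).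
  have E : spherization A = \sum_(j < d) (fun w =>
      (((fun w => (n w)^-1) * (fun w : 'rV[R]_d => (w *m A) 0 j : R)) w) *: (delta_mx 0 j : 'rV[R]_d)).
    apply/funext => w; rewrite fct_sumE /spherization {2}(row_sum_delta (w *m A)) scaler_sumr; apply: eq_bigr => j _.
    by rewrite scalerA.
  have E2 : (fun w : 'rV[R]_d => \sum_(j < d)
     ((n v)^-1 * (w *m A) 0 j - (v *m A) 0 j * (dotv (v *m A) (w *m A) / n v ^+ 3)) *: delta_mx 0 j)
   = \sum_(j < d) (fun w : 'rV[R]_d =>
     ((n v)^-1 * (w *m A) 0 j - (v *m A) 0 j * (dotv (v *m A) (w *m A) / n v ^+ 3)) *: (delta_mx 0 j : 'rV[R]_d)).
    by apply/funext => w; rewrite fct_sumE.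
  rewrite E E2; apply: is_diff_bigsum => j.
  have [dk Ek] := is_diffM din (is_diff_mulmx_coord A v j).
  apply: DiffDef; first exact: differentiableZl.
  rewrite diffZl// Ek; apply/funext => w /=; congr (_ *: _).
  rewrite -[LHS]/((n v)^-1 * (w *m A) 0 j +
    (v *m A) 0 j * - (dotv (v *m A) (w *m A) / n v ^+ 3)).
  by rewrite mulrN.
rewrite diff_val; apply/rowP => j.
rewrite summxE (bigD1 j)//= big1 ?addr0; last first.
  by move=> i ij; rewrite !mxE eqxx /= eq_sym (negbTE ij) mulr0.
rewrite [LHS]mxE [delta_mx _ _ _ _]mxE !eqxx mulr1 [RHS]mxE -/(n v).
have -> (x y : 'rV[R]_d) a : (x - a *: y) 0 j = x 0 j - a * y 0 j by rewrite !mxE.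
rewrite -ns.
by field; rewrite gt_eqF.
Qed.

(** Functoriality of the exterior power, which in coordinates is the Cauchy-Binet formula. [L] is
    kept as a function because it will be a differential. *)
Lemma wedge_mulmx k d (U : 'M[R]_(k, d)) (D : 'M[R]_d) (L : 'rV[R]_d -> 'rV[R]_d) :
  (forall u, L u = u *m D) -> extpow L (wedge U) = wedge (U *m D).
Proof.
move=> LD; apply/ffunP => J; rewrite !ffunE.
have -> : \matrix_(i < k, j < k) (U *m D) i (val J j) =
   U *m (\matrix_(i < d, j < k) D i (val J j)).
  by apply/matrixP => i j; rewrite !mxE; apply: eq_bigr => l _; rewrite mxE.
rewrite Cauchy_Binet; apply: eq_bigr => I _; rewrite !ffunE; congr (_ * \det _).
by apply/matrixP => i j; rewrite !mxE LD -rowE mxE.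
Qed.

Lemma sqrt_le1D (x : R) : 0 <= x -> Num.sqrt x <= 1 + x.
Proof.
move=> x0; have y0 : 0 <= 1 + x by lra.
by rewrite -(ger0_norm y0) -sqrtr_sqr ler_sqrt ?exprn_ge0//; nra.
Qed.

(** The coordinates of [wedge U] are at most [k!], so division by [K] makes it an admissible test
    vector for the operator norm; the shape of [K] comes from [sqrt x <= 1 + x]. *)
Lemma extpow_norm_wedge k d (V : set 'rV[R]_d) (L : 'rV[R]_d -> 'rV[R]_d) (D : 'M[R]_d)
    (U : 'M[R]_(k, d)) (b : R) (I : incidx k d) :
  (forall u, L u = u *m D) -> (forall i, V (row i U)) -> (forall i j, `|U i j| <= 1) ->
  (extpow_norm k V L <= b%:E)%E ->
  `|wedge (U *m D) I| <= (1 + #|{: incidx k d}|%:R * k`!%:R ^+ 2) * b.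
Proof.
move=> LD VU U1; set K := 1 + _ => Hb.
have K0 : 0 < K by rewrite /K ltr_wpDr// mulr_ge0// exprn_ge0.
pose w : extp k d := [ffun J => K^-1 * wedge U J].
have Ew : enorm_ext w <= 1.
  rewrite /enorm_ext (eq_bigr (fun J => K^-1 ^+ 2 * wedge U J ^+ 2)); last first.
    by move=> J _; rewrite ffunE exprMn.
  rewrite -mulr_sumr sqrtrM ?exprn_ge0// ?invr_ge0 ?(ltW K0)// sqrtr_sqr.
  rewrite (ger0_norm (_ : 0 <= K^-1)) ?invr_ge0 ?(ltW K0)// mulrC ler_pdivrMr// mul1r.
  apply: le_trans (sqrt_le1D _) _; first by apply: sumr_ge0 => *; exact: sqr_ge0.
  rewrite lerD2l mulr_natl -sumr_const.
  apply: ler_sum => J _; rewrite ffunE -real_normK ?num_real// lerXn2r ?nnegrE//.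
  by apply: det_le_fact => i j; rewrite mxE.
have : (enorm_ext (extpow L w) <= b).
  rewrite -lee_fin; apply: le_trans Hb; apply: ereal_sup_ubound; exists w => //; split=> //.
  exists 1%N, (fun=> K^-1), (fun=> U); split=> // J.
  by rewrite big_ord1 ffunE.
have -> : extpow L w = [ffun J => K^-1 * wedge (U *m D) J].
  rewrite -(wedge_mulmx U LD); apply/ffunP => J; rewrite ffunE [in RHS]ffunE [in RHS]ffunE.
  by rewrite mulr_sumr; apply: eq_bigr => I' _; rewrite ffunE mulrA.
move=> H; rewrite -ler_pdivrMl//; apply: le_trans H.
rewrite /enorm_ext -[leLHS]ger0_norm ?mulr_ge0 ?invr_ge0 ?(ltW K0)// -sqrtr_sqr ler_sqrt.
  rewrite (bigD1 I)//= [X in _ <= X ^+ 2 + _]ffunE !exprMn real_normK ?num_real//.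
  by rewrite lerDl sumr_ge0// => *; exact: sqr_ge0.
by apply: sumr_ge0 => *; exact: sqr_ge0.
Qed.

(* With [c T = T_jj e_j], the vector [v = c G / |c|] is sent by [A] to [(T_jj / |c|) G'_j] and the
   rows [G_i], [i > j], are tangent to the sphere at [v]; since [|c| >= 1], the minors of the
   differential of the spherization at [v] dominate those of [T / T_jj] beyond index [j]. *)
Lemma flag_minor_le d (A T G G' : 'M[R]_d) (j : 'I_d) k (I J : 'I_k -> 'I_d) (b : R) :
  orthomx G -> orthomx G' -> lower_tri T -> G *m A = T *m G' ->
  (forall i, (j < I i)%N) -> (forall i, (j < J i)%N) ->
  (forall v, sphere v -> (angular_norm k A v <= b%:E)%E) ->
  `|\det (\matrix_(i < k, l < k) (T (I i) (J l) / T j j))| <=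
    #|{: incidx k d}|%:R * k`!%:R * (1 + #|{: incidx k d}|%:R * k`!%:R ^+ 2) * b.
Proof.
move=> oG oG' lT GA jI jJ Hb.
have [Tl Td] := lT.
have [c [cgt cj cT]] := lower_tri_solve j lT.
have c1 : 1 <= dotv c c.
  rewrite /dotv (bigD1 j)//= cj mulr1 lerDl sumr_ge0// => i _.
  by rewrite -expr2 sqr_ge0.
have c0 : 0 < dotv c c by apply: lt_le_trans c1.
pose n := enorm c.
have nn : n * n = dotv c c by rewrite -expr2 sqr_sqrtr// ltW.
have n0 : 0 < n by rewrite sqrtr_gt0.
have n1 : 1 <= n by rewrite -sqrtr1 ler_sqrt// ltW.
pose v := n^-1 *: (c *m G).
have vS : sphere v.
  rewrite /sphere /= /enorm dotvZ dotv_orthomx// -nn.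
  rewrite (_ : _ * _ = 1) ?sqrtr1//; by field; rewrite gt_eqF.
pose t := T j j / n.
have t0 : 0 < t by rewrite divr_gt0.
have vA : v *m A = t *: row j G'.
  rewrite /v -scalemxAl -mulmxA GA mulmxA cT -scalemxAl scalerA -rowE.
  by rewrite /t mulrC.
have jj : dotv (row j G') (row j G') = 1.
  by rewrite !rowE dotv_orthomx// dotv_delta eqxx.
have vAvA : dotv (v *m A) (v *m A) = t * t by rewrite vA dotvZ jj mulr1.
have nvA : enorm (v *m A) = t.
  by rewrite /enorm vAvA -expr2 sqrtr_sqr gtr0_norm.
pose D := t^-1 *: (A - (t * t)^-1 *: (A *m (v *m A)^T *m (v *m A))).
have LD u : 'd (spherization A) v u = u *m D.
  have := @diff_spherization _ A v u; rewrite vAvA nvA => ->; last exact: mulr_gt0.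
  rewrite /D -scalemxAr; congr (_ *: _).
  rewrite mulmxBr -scalemxAr; congr (_ - _).
  have -> : u *m (A *m (v *m A)^T *m (v *m A)) = dotv (v *m A) (u *m A) *: (v *m A).
    move: (v *m A) => y; rewrite !mulmxA -mul_scalar_mx; congr (_ *m _).
    apply/matrixP => x z; rewrite !ord1 [in RHS]mxE eqxx mulr1n /dotv mxE.
    by apply: eq_bigr => i _; rewrite [_^T _ _]mxE mulrC.
  by rewrite scalerA mulrC.
pose U : 'M[R]_(k, d) := \matrix_(i < k, l < d) G (I i) l.
have rU i : row i U = row (I i) G by apply/rowP => l; rewrite !mxE.
have tU i : tangent v (row i U).
  rewrite /tangent /= rU rowE /v -[_ *m G]scale1r dotvZ dotv_orthomx//.
  rewrite (_ : dotv _ _ = 0) ?mulr0//; rewrite /dotv big1// => l _; rewrite !mxE eqxx /=.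
  by case: eqP => [->|_]; rewrite ?mul0r// cgt ?mulr0.
have U1 i l : `|U i l| <= 1 by rewrite mxE orthomx_entry.
clearbody v.
(* Pairing with the target vectors [G'_J] reads off the entries of [T]: the radial term of [D]
   points along [G'_j], which is orthogonal to [G'_J] since all [J l > j]. The factor [n] comes from
   [1 / t = n / T_jj]. *)
pose Y : 'M[R]_(d, k) := \matrix_(l < d, i < k) G' (J i) l.
have UDY : U *m D *m Y = n *: (\matrix_(i < k, l < k) (T (I i) (J l) / T j j)).
  apply/matrixP => i l.
  have -> : (U *m D *m Y) i l = (row i (U *m D) *m G'^T) 0 (J l).
    by rewrite !mxE; apply: eq_bigr => x _; rewrite !mxE.
  rewrite row_mul rU /D -!scalemxAr -!scalemxAl.
  rewrite [LHS]mxE mulmxBr mulmxBl [X in _ * X]mxE -!scalemxAr -!scalemxAl.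
  rewrite [X in _ + X]mxE [X in _ + - X]mxE.
  have -> : (row (I i) G *m (A *m (v *m A)^T *m (v *m A)) *m G'^T) 0 (J l) = 0.
    rewrite vA; move: (A *m _) => Z.
    rewrite -2!mulmxA -scalemxAl -[row j G' *m _]row_mul oG' row1 -!scalemxAr mulmxA.
    rewrite mxE [X in _ * X]mxE big_ord1 [delta_mx _ _ _ _]mxE eqxx /=.
    have /negbTE -> : J l != j by apply/eqP => E; have := jJ l; rewrite E ltnn.
    by rewrite !mulr0.
  rewrite mulr0 subr0 -row_mul GA row_mul -mulmxA oG' mulmx1 [row _ _ _ _]mxE !mxE /t.
  by field; rewrite !gt_eqF.
have detE : \det (U *m D *m Y) = n ^+ k * \det (\matrix_(i < k, l < k) (T (I i) (J l) / T j j)).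
  by rewrite UDY detZ.
have k0 : 0 <= k`!%:R :> R by [].
apply: (@le_trans _ _ `|\det (U *m D *m Y)|).
  rewrite detE normrM -[leLHS]mul1r ler_wpM2r// normrX (gtr0_norm n0).
  by rewrite exprn_ege1.
rewrite Cauchy_Binet; apply: le_trans (ler_norm_sum _ _ _) _.
rewrite -!mulrA mulr_natl -sumr_const; apply: ler_sum => K _.
rewrite normrM mulrC ler_pM//.
  by apply: det_le_fact => x y; rewrite !mxE orthomx_entry.
have := extpow_norm_wedge K LD tU U1 (Hb v vS).
by rewrite ffunE.
Qed.

End AngularNorm.

(** * Flags and affine forms *)

Section Flags.
Context {R : realType} {d : nat}.
Implicit Types (a u w : 'rV[R]_d) (G T A : 'M[R]_d) (c : 'cV[R]_d * R)
  (t : 'rV[R]_d) (cs : seq ('cV[R]_d * R)).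

(* The pair [(c, b)] encodes the affine form [x |-> x c - b]. *)
Definition affv c a : R := (a *m c.1) 0 0 - c.2.

Definition pull A t c : 'cV[R]_d * R := (A *m c.1, c.2 - (t *m c.1) 0 0).

Lemma affv_pull A t c a : affv (pull A t c) a = affv c (a *m A + t).
Proof. by rewrite /affv /= mulmxA mulmxDl [in RHS]mxE opprB addrA addrAC. Qed.

(** The hyperplane of the form contains the point and the first [j] directions; only for such a form
    does the next direction decide the sign. *)
Definition active (j : nat) a G c : Prop :=
  affv c a = 0 /\ forall l : 'I_d, (l < j)%N -> (G *m c.1) l 0 = 0.

(* The sequence [affv c a, G_0 c, ..., G_(j-1) c] is lexicographically nonpositive, i.e. the affine
   form is nonpositive at the infinitesimal point [a + e G_0 + e^2 G_1 + ... + e^j G_(j-1)]. *)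
Definition lexle (j : nat) a G c : Prop :=
  affv c a <= 0 /\ forall l : 'I_d, (l < j)%N -> active l a G c -> (G *m c.1) l 0 <= 0.

Definition adj j cs a G : Prop := forall c, c \in cs -> lexle j a G c.

(* Adjacency to a small piece of the sphere of directions around row [i] of [G]. *)
Definition padj (i : 'I_d) cs a G (r : R) : Prop := adj i cs a G /\
  exists2 u : 'rV[R]_d, (forall l, `|u 0 l| <= r) &
    forall c, c \in cs -> active i a G c -> ((row i G + u) *m c.1) 0 0 <= 0.

Lemma lexle_S (i : 'I_d) a G c :
  lexle i.+1 a G c <-> lexle i a G c /\ (active i a G c -> (G *m c.1) i 0 <= 0).
Proof.
split=> [[c0 H]|[[c0 H] H']].
  by split; [split=> // l li; apply: H; rewrite ltnS ltnW|apply: H].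
split=> // l; rewrite ltnS leq_eqVlt => /orP[/eqP/val_inj ->//|li]; exact: H.
Qed.

Lemma row_mulE k (M : 'M[R]_(k, d)) (v : 'cV[R]_d) l : (M *m v) l 0 = (row l M *m v) 0 0.
Proof. by rewrite -row_mul [RHS]mxE. Qed.

Lemma eq_rows_active j a G G' c : (forall l : 'I_d, (l < j)%N -> row l G' = row l G) ->
  active j a G' c <-> active j a G c.
Proof.
by move=> E; split=> -[c0 H]; split=> // l lj; have := H l lj;
  rewrite (row_mulE G) (row_mulE G') E.
Qed.

Lemma eq_rows_adj j cs a G G' : (forall l : 'I_d, (l < j)%N -> row l G' = row l G) ->
  adj j cs a G -> adj j cs a G'.
Proof.
move=> E H c /H[c0 H']; split=> // l lj.
have El (m : 'I_d) : (m < l)%N -> row m G' = row m G.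
  by move=> ml; apply: E; apply: ltn_trans lj.
by move/(eq_rows_active _ _ El)/(H' l lj); rewrite (row_mulE G) (row_mulE G') E.
Qed.

(** The first nonzero term of the lexicographic sequence is merely multiplied by a positive diagonal
    entry; so activity and adjacency pass from the frame [T *m G] to [G]. *)
Lemma lower_tri_row T G c (l : 'I_d) : lower_tri T ->
  (forall m : 'I_d, (m < l)%N -> (G *m c.1) m 0 = 0) ->
  (T *m G *m c.1) l 0 = T l l * (G *m c.1) l 0.
Proof.
move=> [Tl _] H; rewrite -mulmxA mxE (bigD1 l)//= big1 ?addr0// => m ml.
have [lm|ml'] := ltnP l m; first by rewrite Tl ?mul0r.
by rewrite H ?mulr0// ltn_neqAle ml'; rewrite -val_eqE in ml; rewrite ml.
Qed.

Lemma lower_tri_active j T a G c : lower_tri T -> active j a (T *m G) c <-> active j a G c.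
Proof.
move=> lT; split=> -[c0 H]; split=> //.
  move=> l; have [n] := ubnP (l : nat); elim: n l => // n IH l ln lj.
  have := H l lj; rewrite lower_tri_row//; last first.
    by move=> m ml; apply: IH; [apply: leq_trans ml _|apply: ltn_trans lj].
  by move/eqP; rewrite mulf_eq0 gt_eqF//= ?lT.2// => /eqP.
move=> l lj; rewrite lower_tri_row ?H ?mulr0// => m ml.
by apply: H; apply: ltn_trans lj.
Qed.

Lemma lower_tri_adj j cs T a G : lower_tri T -> adj j cs a (T *m G) -> adj j cs a G.
Proof.
move=> lT H c /H[c0 H']; split=> // l lj al.
have := H' l lj (iffRL (lower_tri_active l a G c lT) al).
by rewrite lower_tri_row ?pmulr_rle0 ?lT.2//; case: al.
Qed.

Lemma active_pull j A t a G c :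
  active j a G (pull A t c) <-> active j (a *m A + t) (G *m A) c.
Proof. by rewrite /active affv_pull /= !mulmxA. Qed.

Lemma adj_pull j A t cs a G :
  adj j [seq pull A t c | c <- cs] a G -> adj j cs (a *m A + t) (G *m A).
Proof.
move=> H c cc; have [c0 H'] := H _ (map_f (pull A t) cc).
split; first by rewrite -affv_pull.
by move=> l lj /active_pull/(H' l lj); rewrite /= mulmxA.
Qed.

(** A Householder reflection in the coordinates of [G]: as [q] has no component before [i], the
    first [i] vectors stay fixed. *)
Lemma reframe (i : 'I_d) G (q : 'rV[R]_d) : orthomx G -> q != 0 ->
  (forall l : 'I_d, (l < i)%N -> q 0 l = 0) ->
  exists G1, [/\ orthomx G1, (forall l : 'I_d, (l < i)%N -> row l G1 = row l G) &
    row i G1 = (enorm q)^-1 *: (q *m G)].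
Proof.
move=> oG q0 ql.
have qq : 0 < dotv q q.
  by rewrite lt_neqAle dotvv_ge0 andbT; apply: contraNneq q0 => /esym/dotvv_eq0 ->.
have nn : enorm q * enorm q = dotv q q by rewrite -expr2 sqr_sqrtr// ltW.
have n0 : 0 < enorm q by rewrite sqrtr_gt0.
have [|H [oH Hi Hl]] := @householder _ _ ((enorm q)^-1 *: q) i.
  by rewrite dotvZ -nn; field; rewrite gt_eqF.
exists (H *m G); split; first exact: orthomx_mul.
  move=> l li; rewrite row_mul Hl -?rowE//.
    by rewrite -val_eqE ltn_eqF.
  by rewrite mxE ql ?mulr0.
by rewrite row_mul Hi scalemxAl.
Qed.

(** * Compactness of the sphere of directions *)

Lemma continuous_sum_prod (T : topologicalType) n (f g : 'I_n -> T -> R) :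
  (forall i, continuous (f i)) -> (forall i, continuous (g i)) ->
  continuous (fun x => \sum_i f i x * g i x).
Proof.
move=> Hf Hg x; rewrite /continuous_at.
have -> : (fun x => \sum_i f i x * g i x) = \sum_i f i * g i.
  by apply/funext => y; rewrite fct_sumE.
have -> : \sum_i f i x * g i x = (\sum_i f i * g i) x by rewrite fct_sumE.
elim/big_ind: _ => //; first exact: cvg_cst.
  by move=> p q gx hx; apply: cvgD.
by move=> i _; apply: cvgM; [apply: Hf|apply: Hg].
Qed.

Lemma continuous_subl (T : topologicalType) (b : R) (f : T -> R) :
  continuous f -> continuous (fun x => b - f x).
Proof. by move=> Hf x; apply: cvgB; [apply: cvg_cst|apply: Hf]. Qed.

Lemma dotv_continuous (w0 : 'rV[R]_d) : continuous (fun w : 'rV[R]_d => dotv (w0 - w) (w0 - w)).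
Proof.
have H i : continuous (fun w : 'rV[R]_d => (w0 - w) 0 i : R).
  have -> : (fun w : 'rV[R]_d => (w0 - w) 0 i : R) = (fun w : 'rV[R]_d => w0 0 i - w 0 i).
    by apply/funext => x; rewrite !mxE.
  by apply: continuous_subl; exact: coord_continuous.
exact: continuous_sum_prod.
Qed.

Lemma form_continuous (c : 'cV[R]_d) : continuous (fun w : 'rV[R]_d => (w *m c) 0 0 : R).
Proof.
rewrite (_ : (fun w : 'rV[R]_d => (w *m c) 0 0 : R) = (fun w : 'rV[R]_d => \sum_i w 0 i * c i 0)).
  apply: continuous_sum_prod => i; first exact: coord_continuous.
  exact: cst_continuous.
by apply/funext => x; rewrite mxE.
Qed.

Lemma compact_unit_sphere : compact [set w : 'rV[R]_d | dotv w w = 1].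
Proof.
apply: bounded_closed_compact.
  exists 1; split; first exact: num_real.
  move=> x x1 w /= ww; rewrite [leLHS]/Num.norm /= mx_normrE; apply/bigmax_leP; split; first by apply/ltW/(lt_trans _ x1).
  move=> [i j] _ /=; rewrite ord1; apply: ltW; apply: le_lt_trans x1.
  rewrite -(expr_le1 (n:=2))// -normrX ger0_norm ?sqr_ge0// -ww /dotv (bigD1 j)//= -expr2.
  by rewrite lerDl sumr_ge0// => l _; rewrite -expr2 sqr_ge0.
have -> : [set w : 'rV[R]_d | dotv w w = 1] =
   (fun w : 'rV[R]_d => dotv (0 - w) (0 - w)) @^-1` [set 1].
  apply/seteqP; split=> w /=; rewrite sub0r -scaleN1r dotvZ mulrNN !mul1r//.
apply: closed_comp; last exact: closed_eq.
by move=> w _; apply: dotv_continuous.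
Qed.

End Flags.

(** Near a unit vector [w], either some form of the chosen subset is positive, and the hypothesis
    fails for small [r], or [w] satisfies them all and serves its whole neighbourhood. Compactness
    and the finite number of subsets make [r] uniform. [P] is arbitrary so that [r] does not depend
    on which forms are active. *)
Lemma halfspaces_lebesgue (R : realType) d (cs : seq 'cV[R]_d) : exists2 r : R, 0 < r &
  forall (P : set 'cV[R]_d) (w : 'rV[R]_d), dotv w w = 1 ->
    (forall c, c \in cs -> P c -> (w *m c) 0 0 <= r) ->
    exists2 w', dotv (w' - w) (w' - w) < 1 & forall c, c \in cs -> P c -> (w' *m c) 0 0 <= 0.
Proof.
pose Q (S : {set 'I_(size cs)}) (r : R) (w : 'rV[R]_d) :=
  (forall i, i \in S -> (w *m cs`_i) 0 0 <= r) ->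
  exists2 w', dotv (w' - w) (w' - w) < 1 & forall i, i \in S -> (w' *m cs`_i) 0 0 <= 0.
have H S : \forall r \near 0^'+, forall w, dotv w w = 1 -> Q S r w.
  have /(_ R 0^'+ (Q S) _) := (compact_near_coveringP _).1 (@compact_unit_sphere R d).
  apply => w _.
  have [[i [iS iw]]|no] := pselect (exists i, i \in S /\ 0 < (w *m cs`_i) 0 0).
    exists ([set w' | (w *m cs`_i) 0 0 / 2 < (w' *m cs`_i) 0 0],
            [set r | r < (w *m cs`_i) 0 0 / 2]).
      split; last by apply: nbhs_right_lt; rewrite divr_gt0.
      have := @form_continuous R d cs`_i w; move/cvgr_gt; apply.
      by rewrite gtr_pMr// invf_lt1 ?ltr1n.
    move=> [w' r] /= [ww' rw] /(_ i iS) wr; exfalso.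
    by have := lt_trans rw ww'; rewrite ltNge wr.
  exists ([set w' | dotv (w - w') (w - w') < 1], setT).
    split; last exact: filterT.
    have := @dotv_continuous R d w w; move/cvgr_lt; apply.
    by rewrite subrr /dotv big1 ?ltr01// => i _; rewrite mxE mul0r.
  move=> [w' r] /= [ww' _] _; exists w => // i iS.
  by rewrite leNgt; apply/negP => ?; apply: no; exists i.
have /filter_forall H' := H.
have [r [r0 rP]] : exists r, 0 < r /\ forall S w, dotv w w = 1 -> Q S r w.
  near (0:R)^'+ => r.
  exists r; split; first by near: r; exact: nbhs_right_gt.
  by near: r; exact: H'.
exists r => // P w w1 Hw.
have [|w' w'1 Hw'] := rP [set i : 'I_(size cs) | `[< P cs`_i >]]%SET w w1.
  by move=> i; rewrite inE => /asboolP Pi; apply: Hw => //; exact: mem_nth.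
exists w' => // c ccs Pc.
have ic : (index c cs < size cs)%N by rewrite index_mem.
have := Hw' (Ordinal ic); rewrite inE /= nth_index//; apply; exact/asboolP.
Unshelve. all: by end_near.
Qed.

(** * Itineraries and pieces *)

Section Covered.
Context {R : realType} {cT : eqType}.

(** A list containing all solutions replaces a cardinality, as the predicates need not be decidable;
    a real bound combines directly with exponentials. *)
Definition covered (P : seq cT -> Prop) (K : R) : Prop :=
  exists2 ss : seq (seq cT), (size ss)%:R <= K & forall s, P s -> s \in ss.

Lemma coveredW (P Q : seq cT -> Prop) K K' : K <= K' -> (forall s, P s -> Q s) ->
  covered Q K -> covered P K'.
Proof.
by move=> KK PQ [ss sK H]; exists ss; [apply: le_trans KK|move=> s /PQ/H].
Qed.

Lemma covered_union (X : eqType) (xs : seq X) P (Q : X -> seq cT -> Prop) K :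
  (forall x, x \in xs -> covered (Q x) K) ->
  (forall s, P s -> exists2 x, x \in xs & Q x s) -> covered P ((size xs)%:R * K).
Proof.
move=> HQ HP.
have H x : exists ss : seq (seq cT), x \in xs -> (size ss)%:R <= K /\ forall s, Q x s -> s \in ss.
  have [/HQ[ss ? ?]|] := boolP (x \in xs); first by exists ss.
  by exists [::].
have [g gP] := choice H.
exists (flatten (map g xs)); last first.
  move=> s /HP[x xx Qx]; apply/flattenP; exists (g x); first exact: map_f.
  by have [_] := gP _ xx; apply.
have {gP} : forall x, x \in xs -> (size (g x))%:R <= K by move=> x /gP[].
elim: xs {HQ HP H} => [|x xs IH] H /=; first by rewrite mul0r.
rewrite size_cat natrD -[(_.+1)]add1n natrD mulrDl mul1r lerD//.
  by apply: H; rewrite mem_head.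
by apply: IH => y yx; apply: H; rewrite inE yx orbT.
Qed.

Lemma covered_cat P P1 (Q : seq cT -> seq cT -> Prop) K1 K2 : 0 <= K2 ->
  covered P1 K1 -> (forall s, P1 s -> covered (Q s) K2) ->
  (forall s, P s -> exists s1 s2, [/\ s = s1 ++ s2, P1 s1 & Q s1 s2]) ->
  covered P (K1 * K2).
Proof.
move=> K20 [ss1 sK H1] H2 H.
apply: (@coveredW _ P ((size ss1)%:R * K2)) => //; first exact: ler_wpM2r.
apply: (@covered_union _ _ _ (fun s1 s => P1 s1 /\ exists2 s2, s = s1 ++ s2 & Q s1 s2)).
  move=> s1 _; have [/H2[ss2 sK2 H2']|nP] := pselect (P1 s1).
    exists (map (cat s1) ss2); first by rewrite size_map.
    by move=> s [_ [s2 -> /H2']]; exact: map_f.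
  by exists [::] => // s [].
by move=> s /H[s1 [s2 [-> P1s Qs]]]; exists s1; [exact: H1|split=> //; exists s2].
Qed.

Lemma covered_all (cells : seq cT) n : exists2 B : R, 0 <= B &
  covered (fun s => (size s <= n)%N /\ all [in cells] s) B.
Proof.
elim: n => [|n [B B0 IH]].
  by exists 1 => //; exists [:: [::]] => // -[|? ?] [].
exists (1 + (size cells)%:R * B); first by rewrite addr_ge0// mulr_ge0.
case: IH => ss sB H; exists ([::] :: [seq z :: s | z <- cells, s <- ss]).
  by rewrite /= size_allpairs -[(_.+1)]add1n natrD natrM lerD2l ler_wpM2l.
move=> [|z s]; rewrite ?mem_head// => -[/= sn /andP[zc sc]].
by rewrite inE; apply/orP; right; apply: allpairs_f => //; apply: H.
Qed.

End Covered.

Section Pieces.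
Context {R : realType} {d : nat}.

Lemma mx_bound m n (M : 'M[R]_(m, n)) : exists2 b, 0 < b & forall i j, `|M i j| <= b.
Proof.
exists (1 + \sum_i \sum_j `|M i j|).
  by rewrite ltr_pwDl// sumr_ge0// => i _; rewrite sumr_ge0.
move=> i j; apply: ler_wpDl => //; rewrite (bigD1 i)//= (bigD1 j)//= -addrA lerDl.
rewrite addr_ge0//; first exact: sumr_ge0.
by apply: sumr_ge0 => k _; apply: sumr_ge0.
Qed.

Lemma seq_bound (I : eqType) (F : I -> R) (s : seq I) :
  exists2 b, 0 < b & forall x, x \in s -> F x <= b.
Proof.
elim: s => [|x s [b b0 H]]; first by exists 1.
exists (Num.max b (F x)); first by rewrite lt_max b0.
move=> y; rewrite inE => /orP[/eqP ->|/H Hy]; rewrite le_max ?lexx ?orbT//.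
by rewrite Hy.
Qed.

Lemma entry_le_enorm (q : 'rV[R]_d) l : `|q 0 l| <= enorm q.
Proof.
rewrite /enorm -sqrtr_sqr ler_sqrt ?dotvv_ge0// /dotv (bigD1 l)//= -expr2 lerDl.
by rewrite sumr_ge0// => i _; rewrite -expr2 sqr_ge0.
Qed.

Lemma mulmx_entry_bound (y : 'rV[R]_d) (G : 'M[R]_d) r l : 0 <= r -> orthomx G ->
  (forall i, `|y 0 i| <= r) -> `|(y *m G) 0 l| <= d%:R * r.
Proof.
move=> r0 oG yr; rewrite -[leRHS]mulr1; apply: rV_norm_mulmx => // i.
exact: orthomx_entry.
Qed.

(** The source of the order [d - 1 - i] of the minors, hence of the index of [rho]. *)
Lemma card_gt_ord (i : 'I_d) : (#|[set x : 'I_d | (i < x)%N]%SET| <= d.-1 - i)%N.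
Proof.
have wi : injective (widen_ord (ltn_ord i)).
  by move=> x y /(congr1 val)/= /val_inj.
have H : (i.+1 <= #|~: [set x : 'I_d | (i < x)%N]%SET|)%N.
  rewrite -[X in (X <= _)%N]card_ord -(card_imset _ wi).
  apply: subset_leq_card; apply/fintype.subsetP => x /imsetP[y _ ->]; rewrite !inE /= -leqNgt.
  by rewrite -ltnS.
have := cardsC [set x : 'I_d | (i < x)%N]%SET; rewrite card_ord; move: H.
by move: (ltn_ord i); lia.
Qed.

(** Modulo the first [i] vectors, and in the chart where the [i]-th coordinate is 1, the action of
    [T] on directions is, after rescaling the source by [s], exactly linear with matrix [L]. So
    [cover_linear_image] applies without any linearization error once the pivot coordinate stays
    positive. *)
Lemma push_piece (i : 'I_d) : exists2 C : R, 0 <= C & forall A : 'M[R]_d, A \in unitmx ->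
  exists2 r0 : R, 0 < r0 & forall (r E : R) (G : 'M[R]_d), 0 < r <= r0 -> orthomx G ->
    (forall T G', orthomx G' -> lower_tri T -> G *m A = T *m G' ->
       forall k (I J : 'I_k -> 'I_d), (k <= d.-1 - i)%N ->
         (forall x, (i < I x)%N) -> (forall x, (i < J x)%N) ->
         `|\det (\matrix_(x < k, y < k) (T (I x) (J y) / T i i))| <= E) ->
    exists Gs : seq 'M[R]_d, [/\ (size Gs)%:R <= C * E, (forall G1, G1 \in Gs -> orthomx G1) &
      forall a cs, adj i cs a (G *m A) ->
        (exists2 u : 'rV[R]_d, (forall l, `|u 0 l| <= r) & forall c, c \in cs ->
           active i a (G *m A) c -> ((row i G + u) *m A *m c.1) 0 0 <= 0) ->
        exists2 G1, G1 \in Gs & padj i cs a G1 r].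
Proof.
have d0 : 0 < d%:R :> R by rewrite ltr0n (leq_trans _ (ltn_ord i)).
(* Passing to the frame [G] costs a factor [d] and the rescaling by [s] a factor 2; the tolerance is
   [r / d] because returning from [G'] costs another [d]. *)
have kap0 : 0 <= 2 * d%:R ^+ 2 :> R by rewrite mulr_ge0// exprn_ge0// ltW.
have [C C0 HC] := @cover_linear_image R d (d.-1 - i) _ kap0.
exists C => // A uA.
have [bA bA0 HbA] := mx_bound A.
have [bV bV0 HbV] := mx_bound (invmx A).
pose bT := d%:R * (d%:R * 1 * bA) * 1.
pose bX := d%:R * (d%:R * 1 * bV) * 1.
have bT0 : 0 < bT by rewrite /bT !mulr1 !mulr_gt0.
have bX0 : 0 < bX by rewrite /bX !mulr1 !mulr_gt0.
have conj_bound (M H H' : 'M[R]_d) b : 0 < b -> (forall x y, `|M x y| <= b) ->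
    orthomx H -> orthomx H' -> forall x y, `|(H *m M *m H') x y| <= d%:R * (d%:R * 1 * b) * 1.
  move=> b0 Mb oH oH' x y.
  have -> : (H *m M *m H') x y = (row x H *m M *m H') 0 y by rewrite -!row_mul [RHS]mxE.
  apply: rV_norm_mulmx => //; first by rewrite !mulr_ge0// ltW.
    move=> z; apply: rV_norm_mulmx => //; first exact: ltW.
    by move=> t; rewrite mxE orthomx_entry.
  by move=> z; apply: orthomx_entry.
(* As [T_ii >= 1 / bX], this radius keeps the [i]-th coordinate of the image above [T_ii / 2]. *)
exists (2 * d%:R ^+ 2 * bT * bX)^-1; first by rewrite invr_gt0 !mulr_gt0// exprn_gt0.
move=> r E G /andP[r0 rr0] oG HE.
have uGA : G *m A \in unitmx by rewrite unitmx_mul uA andbT; have [] := mulmx1_unit oG.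
have [T [G' [lT oG' GA]]] := QR uGA.
have {}HE := HE T G' oG' lT GA.
have [Tl Td] := lT.
have TE : T = G *m A *m G'^T by rewrite GA -mulmxA oG' mulmx1.
have Tb x y : `|T x y| <= bT by rewrite TE; apply: conj_bound => //; exact: orthomx_tr.
pose X := G' *m invmx A *m G^T.
have TX : T *m X = 1%:M.
  rewrite TE /X !mulmxA -(mulmxA _ G'^T) orthomxC// mulmx1 -(mulmxA G A) mulmxV// mulmx1.
  exact: oG.
have Xb x y : `|X x y| <= bX by apply: conj_bound => //; exact: orthomx_tr.
have Tii : bX^-1 <= T i i.
  have [c [_ ci cT]] := lower_tri_solve i lT.
  have : c *m T *m X = c by rewrite -mulmxA TX mulmx1.
  rewrite cT -scalemxAl -rowE => /rowP/(_ i); rewrite mxE [row _ _ _ _]mxE ci => TXi.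
  rewrite -[leLHS]mul1r ler_pdivrMr// -TXi ler_pM2l//.
  by apply: le_trans (ler_norm _) (Xb _ _).
pose L : 'M[R]_d := \matrix_(x, y) if (i < x)%N && (i < y)%N then T x y / T i i else 0.
have E1 : 1 <= E.
  have := HE 0%N (fun x => match x with Ordinal _ h => False_rect _ (notF h) end)
                 (fun x => match x with Ordinal _ h => False_rect _ (notF h) end) isT.
  rewrite det_mx00 normr1; apply; by case.
have [] := HC L [set x : 'I_d | (i < x)%N]%SET E (r / d%:R) (card_gt_ord i).
- by move=> x y; rewrite inE mxE => /negbTE ->.
- exact: divr_gt0.
- move=> k I J km.
  have [/forallP HI|] := boolP [forall x, (i < I x)%N]; last first.
    rewrite negb_forall => /existsP[x /negbTE xI].
    rewrite (expand_det_row _ x) big1 ?normr0 ?(le_trans ler01)// => y _.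
    by rewrite !mxE xI mul0r.
  have [/forallP HJ|] := boolP [forall x, (i < J x)%N]; last first.
    rewrite negb_forall => /existsP[x /negbTE xJ].
    rewrite (expand_det_col _ x) big1 ?normr0 ?(le_trans ler01)// => y _.
    by rewrite !mxE xJ andbF mul0r.
  have := HE k I J km HI HJ; congr (`|\det _| <= _).
  by apply/matrixP => x y; rewrite !mxE HI HJ.
move=> ps sps psP.
(* The lift of a covering point from the chart to a direction. *)
pose q (p : 'rV[R]_d) : 'rV[R]_d := \row_l if l == i then 1 else if (i < l)%N then p 0 l else 0.
have qi p : q p 0 i = 1 by rewrite mxE eqxx.
have q0 p : q p != 0.
  by apply/eqP => /rowP/(_ i); rewrite qi mxE => /eqP; rewrite oner_eq0.
have ql p (l : 'I_d) : (l < i)%N -> q p 0 l = 0.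
  by move=> li; rewrite mxE -val_eqE ltn_eqF// ltnNge ltnW.
have [g gP] := choice (fun p => reframe oG' (q0 p) (ql p)).
exists (map g ps); split; first by rewrite size_map.
  by move=> G1 /mapP[p _ ->]; have [] := gP p.
move=> a cs cadj [u ur Hu].
pose y := u *m G^T.
have yG : y *m G = u by rewrite /y -mulmxA orthomxC// mulmx1.
have yr l : `|y 0 l| <= d%:R * r.
  by apply: mulmx_entry_bound => //; [exact: ltW|exact: orthomx_tr].
pose z := (delta_mx 0 i + y) *m T.
have zE l : z 0 l = T i l + (y *m T) 0 l.
  by rewrite /z mulmxDl -rowE mxE [row _ _ _ _]mxE.
have yT : `|(y *m T) 0 i| <= T i i / 2.
  apply: le_trans (rV_norm_mulmx (a := d%:R * r) (b := bT) _ _ _ _) _ => //.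
  - by rewrite mulr_ge0// ltW.
  - exact: ltW.
  apply: (@le_trans _ _ (d%:R * (d%:R * (2 * d%:R ^+ 2 * bT * bX)^-1) * bT)).
    by rewrite ler_pM2r// ler_pM2l// ler_pM2l.
  have -> : d%:R * (d%:R * (2 * d%:R ^+ 2 * bT * bX)^-1) * bT = bX^-1 / 2.
    by field; rewrite !gt_eqF.
  by rewrite ler_pM2r.
have zi : T i i / 2 <= z 0 i.
  by rewrite zE; move: yT; rewrite ler_norml => /andP[+ _]; lra.
have Ti := Td i.
have zi0 : 0 < z 0 i by apply: lt_le_trans zi; rewrite divr_gt0.
pose s := z 0 i / T i i.
have s0 : 0 < s by rewrite divr_gt0.
have s2 : s^-1 <= 2.
  by rewrite -[2]invrK lef_pV2 ?posrE// ler_pdivlMr// mulrC.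
pose y' := s^-1 *: y.
have [|p pps Hp] := psP y'.
  move=> l; rewrite mxE normrM gtr0_norm ?invr_gt0//.
  have -> : 2 * d%:R ^+ 2 * (r / d%:R) = 2 * (d%:R * r) by field; rewrite gt_eqF.
  by apply: ler_pM => //; rewrite invr_ge0 ltW.
exists (g p); first exact: map_f.
have [oG1 G1l G1i] := gP p.
set n := enorm (q p) in G1i.
have n1 : 1 <= n by rewrite -(normr1 R) -(qi p) entry_le_enorm.
have n0 : 0 < n by apply: lt_le_trans n1.
pose e : 'rV[R]_d := \row_l if (i < l)%N then (y' *m L) 0 l - p 0 l else 0.
have er l : `|(n^-1 *: e) 0 l| <= r / d%:R.
  rewrite mxE normrM gtr0_norm ?invr_gt0// -[leRHS]mul1r ler_pM ?invr_ge0 ?(ltW n0)//.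
    by rewrite invf_le1.
  by rewrite mxE; case: ifP => // _; rewrite normr0 divr_ge0 ?ltW.
have cadj' : adj i cs a G' by apply: (lower_tri_adj lT); rewrite -GA.
split; first exact: eq_rows_adj cadj'.
exists ((n^-1 *: e) *m G').
  move=> l; apply: le_trans (mulmx_entry_bound l (ltW (divr_gt0 r0 d0)) oG' er) _.
  by rewrite mulrC divfK// gt_eqF.
move=> c cs' /(eq_rows_active _ _ G1l) ac.
have ac' : active i a (G *m A) c by rewrite GA; apply/(lower_tri_active _ _ _ _ lT).
have := Hu c cs' ac'.
have -> : (row i G + u) *m A *m c.1 = z *m (G' *m c.1).
  by rewrite /z rowE -yG -mulmxDl -!mulmxA (mulmxA G) GA !mulmxA.
(* Active forms ignore the coordinates before [i]; from [i] on, [z] is the positive multiple [z_i]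
   of [q p + e], so the sign is unchanged. *)
have -> : (z *m (G' *m c.1)) 0 0 = (z 0 i * n) * ((row i (g p) + (n^-1 *: e) *m G') *m c.1) 0 0.
  have -> : (row i (g p) + (n^-1 *: e) *m G') *m c.1 = n^-1 *: ((q p + e) *m (G' *m c.1)).
    by rewrite G1i scalemxAl -mulmxDl -scalerDr -!scalemxAl mulmxA.
  have Zs k (M : 'M[R]_1) : (k *: M) 0 0 = k * M 0 0 by rewrite mxE.
  have Me (v : 'rV[R]_d) (w : 'cV[R]_d) : (v *m w) 0 0 = \sum_l v 0 l * w l 0 by rewrite mxE.
  rewrite Zs mulrA mulfK ?gt_eqF// !Me mulr_sumr; apply: eq_bigr => l _.
  rewrite mulrA; have [li|il|/val_inj il] := ltngtP l i.
  - by rewrite ac.2// !mulr0.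
  - congr (_ * _).
    have -> : (q p + e) 0 l = (y' *m L) 0 l.
      rewrite [(q p + e) 0 l]mxE [q p 0 l]mxE [e 0 l]mxE il -val_eqE gtn_eqF//.
      by rewrite addrC subrK.
    rewrite [z 0 l]zE (Tl i l il) add0r [(y *m T) 0 l]mxE [(y' *m L) 0 l]mxE mulr_sumr.
    apply: eq_bigr => x _; rewrite [y' 0 x]mxE [L x l]mxE il andbT; case: ltnP => [ix|xi].
      by rewrite /s; field; rewrite !gt_eqF.
    by rewrite Tl ?mulr0// (leq_ltn_trans xi).
  - by congr (_ * _); rewrite il [(q p + e) 0 i]mxE qi [e 0 i]mxE ltnn addr0 mulr1.
by rewrite pmulr_rle0// mulr_gt0.
Qed.

End Pieces.

(** * Itineraries and the affine forms of their cells *)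

Section Itineraries.
Context {R : realType} {d : nat} {cT : eqType}.
Context (cells : seq cT) (cf : cT -> seq ('cV[R]_d * R)) (cl : cT -> 'M[R]_d) (ct : cT -> 'rV[R]_d).

Fixpoint ilin (s : seq cT) : 'M[R]_d := if s is Z :: s' then cl Z *m ilin s' else 1%:M.

Fixpoint itr (s : seq cT) : 'rV[R]_d := if s is Z :: s' then ct Z *m ilin s' + itr s' else 0.

Fixpoint iforms (s : seq cT) : seq ('cV[R]_d * R) :=
  if s is Z :: s' then cf Z ++ [seq pull (cl Z) (ct Z) c | c <- iforms s'] else [::].

(** The itinerary is realized by a point: the linear parts are controlled only along actual orbits,
    and [initial_pieces] starts from such a point. *)
Definition adm (s : seq cT) : Prop :=
  all [in cells] s /\ exists x, forall c, c \in iforms s -> affv c x < 0.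

Definition adj_itin n j a G s : Prop := [/\ size s = n, adm s & adj j (iforms s) a G].

Definition piece_itin n i a G r s : Prop := [/\ size s = n, adm s & padj i (iforms s) a G r].

Lemma pull_pull (A A' : 'M[R]_d) (t t' : 'rV[R]_d) c :
  pull A t (pull A' t' c) = pull (A *m A') (t *m A' + t') c.
Proof.
rewrite /pull /= !mulmxA; congr pair.
by rewrite mulmxDl [in RHS]mxE opprD addrA addrAC.
Qed.

Lemma pull_id c : pull 1%:M 0 c = c :> 'cV[R]_d * R.
Proof. by case: c => c b; rewrite /pull /= mul1mx mul0mx mxE subr0. Qed.

Lemma iforms_cat s t : iforms (s ++ t) = iforms s ++ [seq pull (ilin s) (itr s) c | c <- iforms t].
Proof.
elim: s => [|Z s IH] /=; first by rewrite (eq_map pull_id) map_id.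
rewrite IH map_cat catA -map_comp; congr (_ ++ _).
by apply: eq_map => c; rewrite /= pull_pull.
Qed.

Lemma adm_cat s t : adm (s ++ t) -> adm s /\ adm t.
Proof.
rewrite /adm all_cat iforms_cat => -[/andP[sc tc] [x H]]; split; split=> //.
  by exists x => c cs; apply: H; rewrite mem_cat cs.
exists (x *m ilin s + itr s) => c cs; rewrite -affv_pull; apply: H.
by rewrite mem_cat map_f ?orbT.
Qed.

Lemma adj_catP j s t a G : adj j (iforms (s ++ t)) a G ->
  adj j (iforms s) a G /\ adj j (iforms t) (a *m ilin s + itr s) (G *m ilin s).
Proof.
rewrite iforms_cat => H; split; first by move=> c cs; apply: H; rewrite mem_cat cs.
by apply: adj_pull => c cs; apply: H; rewrite mem_cat cs orbT.
Qed.

Lemma padj_catP (i : 'I_d) s t a G r : padj i (iforms (s ++ t)) a G r ->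
  [/\ padj i (iforms s) a G r,
      adj i (iforms t) (a *m ilin s + itr s) (G *m ilin s) &
      exists2 u : 'rV[R]_d, (forall l, `|u 0 l| <= r) & forall c, c \in iforms t ->
        active i (a *m ilin s + itr s) (G *m ilin s) c ->
        ((row i G + u) *m ilin s *m c.1) 0 0 <= 0].
Proof.
move=> [/adj_catP[H1 H2] [u ur H]]; split=> //.
  split=> //; exists u => // c cs; apply: H; first by rewrite iforms_cat mem_cat cs.
exists u => // c cs /active_pull ac.
have := H _ _ ac; rewrite /= mulmxA; apply.
by rewrite iforms_cat mem_cat map_f ?orbT.
Qed.

(** The active forms of all blocks meeting the piece are at most [rL] at [row i G], so one nearby
    direction [w] satisfies all of them at once; these blocks are then adjacent to the single flag
    extended by [w]. *)
Lemma covered_block (i : 'I_d) N (K : R) :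
  (forall a G, orthomx G -> covered (adj_itin N i.+1 a G) K) ->
  exists2 r0, 0 < r0 & forall r a G, 0 <= r <= r0 -> orthomx G ->
    covered (piece_itin N i a G r) K.
Proof.
move=> HK.
have [B B0 [alls _ allsP]] := @covered_all R _ cells N.
pose allc := flatten [seq [seq c.1 | c <- iforms s] | s <- alls].
have [rL rL0 HL] := halfspaces_lebesgue allc.
have [b b0 Hb] := seq_bound (fun c : 'cV[R]_d => \sum_l `|c l 0|) allc.
exists (rL / b); first exact: divr_gt0.
move=> r a G /andP[r0 rr0] oG.
pose P (c1 : 'cV[R]_d) : Prop := exists b s,
  [/\ piece_itin N i a G r s, (c1, b) \in iforms s & active i a G (c1, b)].
have gi1 : dotv (row i G) (row i G) = 1.
  by rewrite !rowE dotv_orthomx// dotv_delta eqxx.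
have mem_allc s c : piece_itin N i a G r s -> c \in iforms s -> c.1 \in allc.
  move=> [sN [sc _] _] cs; apply/flattenP; exists [seq c.1 | c <- iforms s].
    by apply: (map_f (fun s => [seq c.1 | c <- iforms s])); apply: allsP; rewrite sN.
  exact: map_f.
have [|w w1 Hw] := HL P (row i G) gi1.
  move=> c1 c1a [b1 [s [[sN sadm [_ [u ur Hu]]] cs ac]]].
  have := Hu _ cs ac; rewrite /= mulmxDl mxE => H.
  have : - (u *m c1) 0 0 <= rL.
    apply: le_trans (_ : `|(u *m c1) 0 0| <= _); first by rewrite -normrN ler_norm.
    rewrite mxE; apply: le_trans (ler_norm_sum _ _ _) _.
    apply: (@le_trans _ _ (\sum_l r * `|c1 l 0|)).
      by apply: ler_sum => l _; rewrite normrM ler_wpM2r.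
    rewrite -mulr_sumr; apply: (@le_trans _ _ (rL / b * b)); last by rewrite divfK ?gt_eqF.
    by apply: ler_pM => //; [apply: sumr_ge0|apply: Hb].
  by lra.
have wG : w = w *m G^T *m G by rewrite -mulmxA orthomxC// mulmx1.
(* Active forms vanish on the first [i] vectors, so those coordinates of [w] may be dropped.
   Something nonzero remains because [w] is at distance less than 1 from [row i G]. *)
pose q : 'rV[R]_d := \row_l if (i <= l)%N then (w *m G^T) 0 l else 0.
have q0 : q != 0.
  apply/eqP => qz.
  have E : dotv (w - row i G) (w - row i G) =
           dotv (w *m G^T - delta_mx 0 i) (w *m G^T - delta_mx 0 i).
    by rewrite -[RHS](dotv_orthomx _ _ oG) mulmxBl -wG -rowE.
  move: w1; rewrite E ltNge => /negP; apply.
  rewrite /dotv (bigD1 i)//=.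
  have -> : (w *m G^T - delta_mx 0 i) 0 i = -1.
    have /rowP/(_ i) := qz; rewrite !mxE leqnn => H.
    by rewrite H !eqxx sub0r.
  by rewrite mulrNN mulr1 lerDl sumr_ge0// => l _; rewrite -expr2 sqr_ge0.
have ql (l : 'I_d) : (l < i)%N -> q 0 l = 0 by move=> li; rewrite mxE leqNgt li.
have [G1 [oG1 G1l G1i]] := reframe oG q0 ql.
apply: coveredW (lexx _) _ (HK a G1 oG1) => s ps.
have [sN sadm [sadj _]] := ps; split=> // c cs; apply/lexle_S.
have [H1 H2] := eq_rows_adj G1l sadj cs.
split; first by [].
move/(eq_rows_active _ _ G1l) => ac.
rewrite row_mulE G1i -scalemxAl mxE mulr_ge0_le0 ?invr_ge0 ?sqrtr_ge0//.
have -> : (q *m G *m c.1) 0 0 = (w *m c.1) 0 0.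
  rewrite [in RHS]wG -!(mulmxA _ G) [LHS]mxE [RHS]mxE; apply: eq_bigr => l _.
  by rewrite [q 0 l]mxE leqNgt; case: ltnP => // li; rewrite ac.2 ?mulr0.
apply: Hw; first exact: (mem_allc s).
by exists c.2, s; case: (c) cs ac.
Qed.

End Itineraries.

(** * Growth rates *)

Section InitialPieces.
Context {R : realType} {d : nat}.

(** On the direction [x - a] every active form is negative; its component beyond the flag,
    normalized, falls into one of finitely many pieces. *)
Lemma initial_pieces (i : 'I_d) (r : R) : 0 < r -> exists2 C : R, 0 <= C &
  forall G : 'M[R]_d, orthomx G -> exists Gs : seq 'M[R]_d,
    [/\ (size Gs)%:R <= C, (forall G1, G1 \in Gs -> orthomx G1) &
      forall a x cs, (forall c, c \in cs -> affv c x < 0) -> adj i cs a G ->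
        exists2 G1, G1 \in Gs & padj i cs a G1 r].
Proof.
move=> r0.
have d0 : 0 < d%:R :> R by rewrite ltr0n (leq_trans _ (ltn_ord i)).
have d1 : 1 <= d%:R :> R by rewrite ler1n (leq_trans _ (ltn_ord i)).
(* Ensures both [2 * d * del <= r] and [del <= 1 / 2]; the latter keeps the approximating grid point
   away from 0. *)
pose del := r / (2 * d%:R * (1 + r)).
have r1 : 0 < 1 + r by rewrite addr_gt0.
have del0 : 0 < del by rewrite divr_gt0// !mulr_gt0.
have delr : d%:R * (2 * del) <= r.
  have -> : d%:R * (2 * del) = r / (1 + r) by rewrite /del; field; rewrite !gt_eqF.
  by rewrite ler_pdivrMr//; nra.
have del2 : del <= 1 / 2.
  rewrite /del ler_pdivrMr ?mulr_gt0//.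
  have -> : 1 / 2 * (2 * d%:R * (1 + r)) = d%:R * (1 + r) by field.
  by apply: le_trans (ler_peMl _ d1); rewrite ?lerDr// ltW.
have di0 : 0 <= del^-1 by rewrite invr_ge0 ltW.
have [C C0 HC] := grid_coverV d di0.
exists (1 + C); first by rewrite addr_ge0.
move=> G oG; have [ps psC psP] := HC _ del0.
pose q (p : 'rV[R]_d) : 'rV[R]_d := \row_l if (i <= l)%N then p 0 l else 0.
have ql p (l : 'I_d) : (l < i)%N -> q p 0 l = 0 by move=> li; rewrite mxE leqNgt li.
have H p : exists G1, orthomx G1 /\ (q p != 0 ->
     [/\ orthomx G1, (forall l : 'I_d, (l < i)%N -> row l G1 = row l G) &
    row i G1 = (enorm (q p))^-1 *: (q p *m G)]).
  have [q0|/(reframe oG)/(_ (ql p))[G1 H]] := eqVneq (q p) 0; first by exists G.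
  by exists G1; split=> //; case: H.
have [g gP] := choice H.
exists (G :: map g ps); split.
- by rewrite /= size_map -[(_.+1)]add1n natrD lerD2l.
- by move=> G1; rewrite inE => /orP[/eqP ->//|/mapP[p _ ->]]; case: (gP p).
move=> a x cs csx cadj.
pose w := x - a.
have wc c : c \in cs -> active i a G c -> (w *m c.1) 0 0 < 0.
  move=> /csx cx [ca _]; rewrite mulmxBl.
  have -> (M N : 'M[R]_1) : (M - N) 0 0 = M 0 0 - N 0 0 by rewrite !mxE.
  by move: cx ca; rewrite /affv => cx ca; lra.
pose z := w *m G^T.
have wG : w = z *m G by rewrite /z -mulmxA orthomxC// mulmx1.
have qz c : active i a G c -> (q z *m (G *m c.1)) 0 0 = (w *m c.1) 0 0.
  move=> [_ ac]; rewrite wG -mulmxA mxE [RHS]mxE; apply: eq_bigr => l _.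
  by rewrite [q z 0 l]mxE leqNgt; case: ltnP => // li; rewrite ac ?mulr0.
(* A zero component rules out active forms altogether, and [G] itself serves. *)
have [q0|q0] := eqVneq (q z) 0.
  exists G; first by rewrite mem_head.
  split=> //; exists 0; first by move=> l; rewrite mxE normr0 ltW.
  move=> c cc ac; have := wc c cc ac; rewrite -qz// q0 mul0mx [X in X < _]mxE ltxx.
  by [].
have [m mq] : exists m, q z 0 m != 0.
  apply/existsP; apply: contraNT q0 => /existsPn H0; apply/eqP/rowP => l.
  by have := H0 l; rewrite negbK [RHS]mxE => /eqP.
pose k := [arg max_(l > m) `|q z 0 l|]%O.
have kmax l : `|q z 0 l| <= `|q z 0 k|.
  by rewrite /k; case: arg_maxP => // j _ /(_ l isT).
have k0 : 0 < `|q z 0 k| by apply: lt_le_trans (kmax m); rewrite normr_gt0.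
set M := `|q z 0 k| in kmax k0.
pose z1 : 'rV[R]_d := M^-1 *: q z.
have z1l l : `|z1 0 l| <= 1.
  by rewrite mxE normrM gtr0_norm ?invr_gt0// mulrC ler_pdivrMr// mul1r.
have z1k : `|z1 0 k| = 1.
  by rewrite mxE normrM gtr0_norm ?invr_gt0// mulVf// gt_eqF.
have [|p pps Hp] := psP z1; first by move=> l; rewrite mulVf ?gt_eqF.
have Hq l : `|z1 0 l - q p 0 l| <= del.
  rewrite [q p 0 l]mxE; case: leqP => // li.
  by rewrite [z1 0 l]mxE ql// mulr0 subrr normr0 ltW.
have n2 : 1 / 2 <= enorm (q p).
  apply: le_trans (entry_le_enorm _ k).
  have := ler_distD (q p 0 k) (z1 0 k) 0; rewrite !subr0 z1k => H1.
  by have := Hq k; lra.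
have n0 : 0 < enorm (q p) by apply: lt_le_trans n2.
have qp0 : q p != 0.
  apply: contraTneq n0 => ->; rewrite /enorm /dotv big1 ?sqrtr0 ?ltxx// => l _.
  by rewrite mxE mul0r.
have [oG1 /(_ qp0)[_ G1l G1i]] := gP p.
exists (g p); first by rewrite inE map_f ?orbT.
split; first exact: eq_rows_adj cadj.
set n := enorm (q p) in n2 n0 G1i.
pose e := n^-1 *: (z1 - q p).
have er l : `|e 0 l| <= 2 * del.
  have -> : e 0 l = n^-1 * (z1 0 l - q p 0 l) by rewrite /e mxE [(z1 - q p) 0 l]mxE [(- q p) 0 l]mxE.
  rewrite normrM gtr0_norm ?invr_gt0// ler_pM ?invr_ge0 ?(ltW n0)//.
  by rewrite -[2]invrK lef_pV2 ?posrE//; move: n2; rewrite mul1r.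
exists (e *m G).
  move=> l; apply: le_trans delr; apply: mulmx_entry_bound => //.
  by rewrite mulr_ge0// ltW.
move=> c cc /(eq_rows_active _ _ G1l) ac.
have -> : (row i (g p) + e *m G) *m c.1 = (n^-1 * M^-1) *: (q z *m (G *m c.1)).
  rewrite G1i scalemxAl -mulmxDl -scalerDr addrC subrK /z1 scalerA -!scalemxAl mulmxA.
  by [].
rewrite [X in X <= _]mxE qz// mulr_ge0_le0//; last exact/ltW/wc.
by rewrite mulr_ge0 ?invr_ge0 ?(ltW n0) ?(ltW k0).
Qed.

(* For small [t > 0] this curve lies in every cell adjacent to the full flag. *)
Definition flag_curve (a : 'rV[R]_d) (G : 'M[R]_d) (t : R) : 'rV[R]_d :=
  a + \sum_(l < d) t ^+ l.+1 *: row l G.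

Lemma affv_flag_curve a G t c :
  affv c (flag_curve a G t) = affv c a + \sum_(l < d) t ^+ l.+1 * (G *m c.1) l 0.
Proof.
have Dm (M N : 'M[R]_1) : (M + N) 0 0 = M 0 0 + N 0 0 by rewrite mxE.
rewrite /affv /flag_curve mulmxDl mulmx_suml Dm summxE addrAC; congr (_ + _).
by apply: eq_bigr => l _; rewrite -scalemxAl -row_mul [LHS]mxE [row _ _ _ _]mxE.
Qed.

(** Along the curve the form is a polynomial in [t] whose first nonzero coefficient is negative by
    [lexle]. Such a coefficient exists because [G] is invertible and [c.1] nonzero; [S] controls the
    tail. *)
Lemma flag_curve_neg a G c : G \in unitmx -> c.1 != 0 -> lexle d a G c ->
  exists2 t0 : R, 0 < t0 & forall t, 0 < t < t0 -> affv c (flag_curve a G t) < 0.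
Proof.
move=> uG c0 [ca cl].
pose S := 1 + \sum_(l < d) `|(G *m c.1) l 0|.
have S0 : 0 < S by rewrite ltr_pwDl// sumr_ge0.
have tail (P : pred 'I_d) m t : 0 < t <= 1 -> (forall l, P l -> (m <= l)%N) ->
   \sum_(l < d | P l) t ^+ l.+1 * (G *m c.1) l 0 <= t ^+ m.+1 * (S - 1).
  move=> /andP[t0 t1] Pm.
  have -> : S - 1 = \sum_(l < d) `|(G *m c.1) l 0| by rewrite /S; ring.
  rewrite mulr_sumr [leRHS](bigID P)/= -[leLHS]addr0 lerD//.
    apply: ler_sum => l /Pm ml; apply: le_trans (_ : t ^+ l.+1 * `|(G *m c.1) l 0| <= _).
      by rewrite ler_pM2l ?exprn_gt0// ler_norm.
    by rewrite ler_wpM2r// ler_wiXn2l// ltW.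
  by apply: sumr_ge0 => l _; rewrite mulr_ge0// exprn_ge0// ltW.
have [ca0|ca0] := eqVneq (affv c a) 0; last first.
  have can : affv c a < 0 by rewrite lt_neqAle ca0.
  exists (Num.min 1 (- affv c a / S)); first by rewrite lt_min ltr01 divr_gt0// oppr_gt0.
  move=> t /andP[t0]; rewrite lt_min => /andP[t1 tS].
  rewrite affv_flag_curve; have := tail xpredT 0%N t; rewrite t0 (ltW t1) => /(_ isT (fun _ _ => isT)).
  rewrite expr1; move: tS; rewrite ltr_pdivlMr// => tS H; nra.
have [k0 Hk0] : exists k, (G *m c.1) k 0 != 0.
  apply/existsP; apply: contraNT c0 => /existsPn H0; apply/eqP.
  rewrite -[c.1](mulKmx uG); have -> : G *m c.1 = 0; last by rewrite mulmx0.
  by apply/colP => l; have := H0 l; rewrite negbK [RHS]mxE => /eqP.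
case: (arg_minnP (P := fun k => (G *m c.1) k 0 != 0) (fun k : 'I_d => k : nat) Hk0) => k Hk kmin.
have kz (l : 'I_d) : (l < k)%N -> (G *m c.1) l 0 = 0.
  by move=> lk; apply/eqP/negPn/negP => /kmin; rewrite leqNgt lk.
set v := (G *m c.1) k 0 in Hk.
have vn : v < 0 by rewrite lt_neqAle Hk cl.
exists (Num.min 1 (- v / S)); first by rewrite lt_min ltr01 divr_gt0// oppr_gt0.
move=> t /andP[t0]; rewrite lt_min => /andP[t1 tS].
rewrite affv_flag_curve ca0 add0r (bigID (fun l : 'I_d => (k < l)%N)) /=.
have := tail (fun l : 'I_d => (k < l)%N) k.+1 t; rewrite t0 (ltW t1) => /(_ isT (fun _ => id)) H1.
have -> : \sum_(l < d | ~~ (k < l)%N) t ^+ l.+1 * (G *m c.1) l 0 = t ^+ k.+1 * v.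
  rewrite (bigD1 k) ?ltnn//= big1 ?addr0// => l /andP[]; rewrite -leqNgt => lk lk'.
  by rewrite kz ?mulr0// ltn_neqAle lk andbT.
apply: le_lt_trans (lerD H1 (lexx _)) _.
rewrite exprS -mulrA mulrCA -mulrDr pmulr_rlt0 ?exprn_gt0//.
by move: tS; rewrite ltr_pdivlMr// => tS; nra.
Qed.

Lemma flag_curve_negs a G (cs : seq ('cV[R]_d * R)) : G \in unitmx ->
  (forall c, c \in cs -> c.1 != 0) -> adj d cs a G ->
  exists2 t0 : R, 0 < t0 & forall t c, 0 < t < t0 -> c \in cs -> affv c (flag_curve a G t) < 0.
Proof.
move=> uG; elim: cs => [|c cs IH] c0 cadj; first by exists 1.
have [|||t1 t10 H1] := @flag_curve_neg a G c => //.
- by apply: c0; rewrite mem_head.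
- by apply: cadj; rewrite mem_head.
have [||t2 t20 H2] := IH; first by move=> c' cc; apply: c0; rewrite inE cc orbT.
  by move=> c' cc; apply: cadj; rewrite inE cc orbT.
exists (Num.min t1 t2); first by rewrite lt_min t10.
move=> t c'; rewrite lt_min => /and3P[t0 tt1 tt2]; rewrite inE => /orP[/eqP ->|cc].
  by apply: H1; rewrite t0.
by apply: H2 => //; rewrite t0.
Qed.

End InitialPieces.

(** * Induction on the length of the flags *)

Section Growth.
Context {R : realType} {d : nat} {cT : eqType}.
Context (cells : seq cT) (cf : cT -> seq ('cV[R]_d * R)) (cl : cT -> 'M[R]_d) (ct : cT -> 'rV[R]_d).
Context (cl_unit : forall Z, Z \in cells -> cl Z \in unitmx).

Local Notation iforms := (iforms cf cl ct).
Local Notation ilin := (ilin cl).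
Local Notation itr := (itr cl ct).
Local Notation adm := (adm cells cf cl ct).
Local Notation adj_itin := (adj_itin cells cf cl ct).
Local Notation piece_itin := (piece_itin cells cf cl ct).

Lemma ilin_unit s : all [in cells] s -> ilin s \in unitmx.
Proof.
elim: s => [|Z s IH] /=; first by rewrite unitmx1.
by move=> /andP[/cl_unit uZ /IH us]; rewrite unitmx_mul uZ.
Qed.

(** Both first cells contain the flag curve for small times, hence coincide, and the flag is pushed
    forward. Its image is no longer orthonormal, so only invertibility of [G] is assumed. *)
Lemma full_flag_unique a G s s' :
  (forall Z c, Z \in cells -> c \in cf Z -> c.1 != 0) ->
  (forall Z Z' x, Z \in cells -> Z' \in cells -> (forall c, c \in cf Z -> affv c x < 0) ->
     (forall c, c \in cf Z' -> affv c x < 0) -> Z = Z') ->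
  G \in unitmx -> all [in cells] s -> all [in cells] s' -> size s = size s' ->
  adj d (iforms s) a G -> adj d (iforms s') a G -> s = s'.
Proof.
move=> cf0 disj; elim: s s' a G => [|Z s IH] [|Z' s'] a G //= uG /andP[Zc sc] /andP[Zc' sc'].
move=> [ss] H H'.
have HZ : adj d (cf Z) a G by move=> c cZ; apply: H; rewrite mem_cat cZ.
have HZ' : adj d (cf Z') a G by move=> c cZ; apply: H'; rewrite mem_cat cZ.
have [t1 t10 H1] := flag_curve_negs uG (fun c => cf0 Z c Zc) HZ.
have [t2 t20 H2] := flag_curve_negs uG (fun c => cf0 Z' c Zc') HZ'.
pose t := Num.min t1 t2 / 2.
have m0 : 0 < Num.min t1 t2 by rewrite lt_min t10.
have tm : t < Num.min t1 t2 by rewrite /t gtr_pMr// invf_lt1 ?ltr1n.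
have t0 : 0 < t by rewrite divr_gt0.
move: tm; rewrite lt_min => /andP[tt1 tt2].
have ZZ : Z = Z'.
  apply: (disj _ _ (flag_curve a G t)) => // c cc.
    by apply: H1 => //; rewrite t0.
  by apply: H2 => //; rewrite t0.
subst Z'; congr (_ :: _).
apply: (IH _ (a *m cl Z + ct Z) (G *m cl Z)) => //.
- by rewrite unitmx_mul uG cl_unit.
- by apply: adj_pull => c cc; apply: H; rewrite mem_cat cc orbT.
- by apply: adj_pull => c cc; apply: H'; rewrite mem_cat cc orbT.
Qed.

(** There are [K1] choices of a block and [K2] pieces covering its image, from which the count
    restarts; [B] pays for the last incomplete block. *)
Lemma covered_pieces (i : 'I_d) N (r B K1 K2 K : R) : (0 < N)%N -> 0 <= K1 -> 0 <= K2 -> 0 <= B ->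
  1 <= K -> K1 * K2 <= K ->
  covered (fun s => (size s <= N)%N /\ all [in cells] s) B ->
  (forall a G, orthomx G -> covered (piece_itin N i a G r) K1) ->
  (forall s G, size s = N -> adm s -> orthomx G ->
    exists Gs : seq 'M[R]_d, [/\ (size Gs)%:R <= K2, (forall G1, G1 \in Gs -> orthomx G1) &
      forall a cs, adj i cs a (G *m ilin s) ->
        (exists2 u : 'rV[R]_d, (forall l, `|u 0 l| <= r) & forall c, c \in cs ->
           active i a (G *m ilin s) c -> ((row i G + u) *m ilin s *m c.1) 0 0 <= 0) ->
        exists2 G1, G1 \in Gs & padj i cs a G1 r]) ->
  forall q n a G, (n <= q * N)%N -> orthomx G -> covered (piece_itin n i a G r) (B * K ^+ q).
Proof.
move=> N0 K10 K20 B0 K1' KK HB H1 H2; have K0 : 0 <= K by apply: le_trans K1'.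
elim=> [|q IH] n a G nq oG.
  rewrite expr0 mulr1; apply: coveredW (lexx _) _ HB => s [sn [sc _] _]; split=> //.
  by rewrite sn (leq_trans nq).
have [nN|Nn] := leqP n N.
  apply: coveredW _ _ HB; first by rewrite ler_peMr// exprn_ege1.
  by move=> s [sn [sc _] _]; split=> //; rewrite sn.
apply: (@coveredW _ _ _ (piece_itin n i a G r) (K1 * (K2 * (B * K ^+ q)))) => //.
  have -> : K1 * (K2 * (B * K ^+ q)) = K1 * K2 * (B * K ^+ q) by ring.
  rewrite exprS [leRHS]mulrCA.
  by rewrite ler_wpM2r// mulr_ge0// exprn_ge0.
apply: (@covered_cat _ _ _ (piece_itin N i a G r) (fun s1 s2 => piece_itin n i a G r (s1 ++ s2))).
- by rewrite !mulr_ge0// exprn_ge0.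
- exact: H1.
- move=> s1 [s1N s1adm _]; have [Gs [GsK Gso GsP]] := H2 s1 G s1N s1adm oG.
  apply: (@coveredW _ _ _ (fun s2 => piece_itin n i a G r (s1 ++ s2)) ((size Gs)%:R * (B * K ^+ q))) => //.
    by rewrite ler_wpM2r// mulr_ge0// exprn_ge0.
  apply: (@covered_union _ _ _ _ _ (fun G1 => piece_itin (n - N) i (a *m ilin s1 + itr s1) G1 r)).
    move=> G1 /Gso oG1; apply: IH => //.
    by move: nq; rewrite mulSn; lia.
  move=> s2 [ssn ssadm /padj_catP[_ s2adj s2u]].
  have [G1 G1s G1p] := GsP _ _ s2adj s2u.
  exists G1 => //; split=> //; last by have [] := adm_cat ssadm.
  by move: ssn; rewrite size_cat s1N => <-; rewrite addKn.
- move=> s ps; have [sn sadm spadj] := ps; exists (take N s), (drop N s).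
  rewrite cat_take_drop; split=> //.
  move: sadm spadj; rewrite -{1 2}(cat_take_drop N s) => /adm_cat[tadm _] /padj_catP[tp _ _].
  by split=> //; rewrite size_takel// sn ltnW.
Qed.

(** [C] is uniform in the flag because base point and frame change after each block. *)
Definition growth (j : nat) (h : R) : Prop := forall eps, 0 < eps ->
  exists2 C : R, 0 <= C & forall n a G, orthomx G ->
    covered (adj_itin n j a G) (C * expR (n%:R * (h + eps))).

Lemma growth_full :
  (forall Z c, Z \in cells -> c \in cf Z -> c.1 != 0) ->
  (forall Z Z' x, Z \in cells -> Z' \in cells -> (forall c, c \in cf Z -> affv c x < 0) ->
     (forall c, c \in cf Z' -> affv c x < 0) -> Z = Z') ->
  growth d 0.
Proof.
move=> cf0 disj eps e0; exists 1 => // n a G oG.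
apply: (@coveredW _ _ _ (adj_itin n d a G) 1) => //.
  by rewrite mul1r add0r -[leLHS]expR0 ler_expR mulr_ge0// ltW.
have uG : G \in unitmx by have [] := mulmx1_unit oG.
have [[s sP]|no] := pselect (exists s, adj_itin n d a G s); last first.
  by exists [::] => // s sP; case: no; exists s.
exists [:: s] => // s' [sn' [sc' _] sadj']; have [sn [sc _] sadj] := sP.
rewrite inE; apply/eqP; apply: (full_flag_unique cf0 disj uG sc' sc _ sadj' sadj).
by rewrite sn sn'.
Qed.

Lemma growth_step (i : 'I_d) (h e : R) : 0 <= h -> 0 <= e -> growth i.+1 h ->
  (forall eps, 0 < eps -> exists C n0, 0 <= C /\ forall n s T G G', (n0 <= n)%N -> size s = n ->
     adm s -> orthomx G -> orthomx G' -> lower_tri T -> G *m ilin s = T *m G' ->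
     forall k (I J : 'I_k -> 'I_d), (k <= d.-1 - i)%N ->
       (forall x, (i < I x)%N) -> (forall x, (i < J x)%N) ->
       `|\det (\matrix_(x < k, y < k) (T (I x) (J y) / T i i))| <= C * expR (n%:R * (e + eps))) ->
  growth i (h + e).
Proof.
move=> h0 e0 Hh He eps eps0.
have [Cp Cp0 HCp] := @push_piece R d i.
have eps4 : 0 < eps / 4 by rewrite divr_gt0.
have [C1 C10 H1] := Hh _ eps4.
have [C2 [n0 [C20 H2]]] := He _ eps4.
pose C3 := C1 * (Cp * C2).
have C30 : 0 <= C3 by rewrite !mulr_ge0.
(* A block length for which all constants together cost at most [eps / 4] in the rate. *)
have [N [N0 Nn0 NC]] : exists N, [/\ (0 < N)%N, (n0 <= N)%N & C3 <= expR (N%:R * (eps / 4))].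
  pose x := C3 / (eps / 4).
  have x0 : 0 <= x by rewrite divr_ge0// ltW.
  exists (maxn n0 (Num.truncn x).+1); split; rewrite ?leq_maxl ?leq_max ?ltnS ?orbT//.
  set m := maxn _ _.
  have xm : x <= m%:R.
    have /andP[_ /ltW xu] := truncn_itv x0; apply: le_trans xu _.
    by rewrite ler_nat leq_maxr.
  apply: le_trans (expR_ge1Dx _); rewrite ler_wpDl// -ler_pdivrMr//.
pose K1 := C1 * expR (N%:R * (h + eps / 4)).
pose E := C2 * expR (N%:R * (e + eps / 4)).
pose K := expR (N%:R * (h + e + 3 * (eps / 4))).
have hee : 0 <= h + e + 3 * (eps / 4) by lra.
have K1K : 1 <= K by rewrite -[leLHS]expR0 ler_expR mulr_ge0.
have KK : K1 * (Cp * E) <= K.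
  have -> : K1 * (Cp * E) = C3 * expR (N%:R * (h + e + 2 * (eps / 4))).
    have -> : N%:R * (h + e + 2 * (eps / 4)) = N%:R * (h + eps / 4) + N%:R * (e + eps / 4) by ring.
    by rewrite expRD /K1 /E /C3; ring.
  have -> : K = expR (N%:R * (eps / 4)) * expR (N%:R * (h + e + 2 * (eps / 4))).
    by rewrite -expRD /K; congr expR; ring.
  by rewrite ler_pM2r ?expR_gt0.
have [r1 r10 Hr1] := covered_block (H1 N).
have [B B0 HB] := @covered_all R _ cells N.
have [alls HA] : exists alls : seq (seq cT), forall s, size s = N -> all [in cells] s -> s \in alls.
  by case: HB => alls _ HA; exists alls => s sN sc; apply: HA; rewrite sN.
(* The radius given by [push_piece] depends on the linear part; finitely many blocks have length
   [N], so a common radius exists. *)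
have [r2 r20 Hr2] : exists2 r2 : R, 0 < r2 & forall r s G, 0 < r <= r2 -> size s = N -> adm s -> orthomx G ->
    exists Gs : seq 'M[R]_d, [/\ (size Gs)%:R <= Cp * E, (forall G1, G1 \in Gs -> orthomx G1) &
      forall a cs, adj i cs a (G *m ilin s) ->
        (exists2 u : 'rV[R]_d, (forall l, `|u 0 l| <= r) & forall c, c \in cs ->
           active i a (G *m ilin s) c -> ((row i G + u) *m ilin s *m c.1) 0 0 <= 0) ->
        exists2 G1, G1 \in Gs & padj i cs a G1 r].
  have Hs s : exists rs : R, 0 < rs /\ (size s = N -> adm s -> forall r G, 0 < r <= rs -> orthomx G ->
    exists Gs : seq 'M[R]_d, [/\ (size Gs)%:R <= Cp * E, (forall G1, G1 \in Gs -> orthomx G1) &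
      forall a cs, adj i cs a (G *m ilin s) ->
        (exists2 u : 'rV[R]_d, (forall l, `|u 0 l| <= r) & forall c, c \in cs ->
           active i a (G *m ilin s) c -> ((row i G + u) *m ilin s *m c.1) 0 0 <= 0) ->
        exists2 G1, G1 \in Gs & padj i cs a G1 r]).
    have [sc|nsc] := boolP (all [in cells] s); last by exists 1; split=> // _ []; rewrite (negbTE nsc).
    have [rs rs0 Hrs] := HCp _ (ilin_unit sc).
    exists rs; split=> // sN sadm r G rrs oG; apply: Hrs => // T G' oG' lT GA.
    exact: (H2 N s T G G').
  have [rr rrP] := choice Hs.
  have [b b0 Hb] := seq_bound (fun s => (rr s)^-1) alls.
  exists b^-1; first by rewrite invr_gt0.
  move=> r s G /andP[r0 rb] sN sadm oG; have [rs0 Hrs] := rrP s.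
  apply: Hrs => //; rewrite r0 (le_trans rb)// -[rr s]invrK lef_pV2 ?posrE ?invr_gt0//.
  by apply: Hb; apply: HA => //; case: sadm.
pose r := Num.min r1 r2.
have r0 : 0 < r by rewrite lt_min r10.
have [C0 C00 HC0] := initial_pieces i r0.
exists (C0 * (B * K)); first by rewrite !mulr_ge0// expR_ge0.
move=> n a G oG; have [Gs [GsC Gso GsP]] := HC0 G oG.
(* The additional block costs one factor [K], which goes into the constant. *)
pose q := (n %/ N).+1.
have nq : (n <= q * N)%N by rewrite ltnW// ltn_ceil.
apply: (@coveredW _ _ _ (adj_itin n i a G) ((size Gs)%:R * (B * K ^+ q))) => //; last first.
  apply: (@covered_union _ _ _ _ _ (fun G1 => piece_itin n i a G1 r)).
    move=> G1 /Gso oG1.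
    apply: (@covered_pieces i N r B K1 (Cp * E) K) => //.
    - by rewrite mulr_ge0// expR_ge0.
    - by rewrite !mulr_ge0// expR_ge0.
    - by move=> a' G' oG'; apply: Hr1 => //; rewrite ltW//= /r ge_min lexx.
    - by move=> s G' sN sadm oG'; apply: Hr2 => //; rewrite r0 /r ge_min lexx orbT.
  move=> s [sn sadm sadj]; have [sc [x sx]] := sadm.
  by have [G1 G1s G1p] := GsP a x _ sx sadj; exists G1.
apply: (@le_trans _ _ (C0 * (B * K ^+ q))).
  by rewrite ler_wpM2r// mulr_ge0// exprn_ge0// expR_ge0.
rewrite -!mulrA ler_wpM2l// ler_wpM2l// /q exprS ler_pM2l ?expR_gt0//.
rewrite /K -expRM_natl ler_expR mulrA -natrM; apply: ler_pM => //.
  by rewrite ler_nat leq_trunc_div.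
by rewrite lerD2l; lra.
Qed.

End Growth.

(** * Piecewise affine maps *)

Section ExtendedReals.
Context {R : realType}.
Local Open Scope ereal_scope.

Lemma lne_le (x : \bar R) (b : R) : x <= (expR b)%:E -> lne x <= b%:E.
Proof.
case: x => [r rb| |]; rewrite ?leye_eq ?leNye//=.
rewrite lee_fin in rb; case: ifPn; rewrite ?leNye// -ltNge => r0.
by rewrite lee_fin -[leRHS]expRK ler_ln ?posrE ?expR_gt0.
Qed.

Lemma lne_le_inv (x : \bar R) (b : R) : lne x <= b%:E -> x <= (expR b)%:E.
Proof.
case: x => [r| |]; rewrite ?leye_eq ?leNye//=; case: ifPn => r0.
  by rewrite lee_fin => _; apply: le_trans r0 _; rewrite expR_ge0.
by rewrite -ltNge in r0; rewrite !lee_fin => H; rewrite -[leLHS]lnK ?posrE// ler_expR.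
Qed.

Lemma limn_esup_le_near (u : nat -> \bar R) x n0 :
  (forall n, (n0 <= n)%N -> u n <= x) -> limn_esup u <= x.
Proof.
move=> H; rewrite /limn_esup limf_esupE.
apply: le_trans (_ : ereal_sup [set u n | n in [set n | (n0 <= n)%N]] <= _).
  by apply: ereal_inf_lbound; exists [set n | (n0 <= n)%N] => //; exists n0.
by apply: ge_ereal_sup => _ [n /= n0n <-]; apply: H.
Qed.

Lemma limn_esup_lt_near (u : nat -> \bar R) x : limn_esup u < x ->
  exists n0, forall n, (n0 <= n)%N -> u n <= x.
Proof.
rewrite /limn_esup limf_esupE => /ereal_inf_lt[_ [V [n0 _ n0V] <-] Vx].
exists n0 => n n0n; apply/ltW/(le_lt_trans _ Vx); apply: ereal_sup_ubound.
by exists n => //; apply: n0V.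
Qed.

End ExtendedReals.

Section AngularNormZero.
Context {R : realType} {d : nat}.

Definition incidx0 : incidx 0 d.
Proof.
apply: (@exist _ _ [ffun i : 'I_0 => match i with Ordinal _ h => False_rect _ (notF h) end]).
by apply/forallP => -[].
Defined.

Lemma incidx0_eq (I : incidx 0 d) : I = incidx0.
Proof. by apply/val_inj/ffunP => -[]. Qed.

Lemma angular_norm0_ge1 (A : 'M[R]_d) v : (1%:E <= angular_norm 0 A v)%E.
Proof.
have S (F : incidx 0 d -> R) : \sum_I F I = F incidx0.
  by rewrite (bigD1 incidx0)//= big1 ?addr0// => I /eqP; rewrite (incidx0_eq I).
have W (U : 'M[R]_(0, d)) I : wedge U I = 1 by rewrite ffunE det_mx00.
apply: ereal_sup_ubound; exists (wedge 0).
  split; last by rewrite /enorm_ext S W expr1n sqrtr1.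
  exists 1%N, (fun=> 1), (fun=> 0); split; first by move=> ? [].
  by move=> J; rewrite big_ord1 mul1r.
by congr EFin; rewrite /enorm_ext S ffunE S !W mul1r expr1n sqrtr1.
Qed.

End AngularNormZero.

(** * From piecewise affine maps to itineraries *)

Section PiecewiseAffine.
Context {R : realType} {d : nat} {X : set 'rV[R]_d} (f : paff X).

Lemma paff_constraints : exists cf : set 'rV[R]_d -> seq ('cV[R]_d * R), forall Z, pcells f Z ->
  (forall x, Z x <-> forall c, c \in cf Z -> affv c x < 0) /\ (forall c, c \in cf Z -> c.1 != 0).
Proof.
suff : forall Z, exists cs : seq ('cV[R]_d * R), pcells f Z ->
  (forall x, Z x <-> forall c, c \in cs -> affv c x < 0) /\ (forall c, c \in cs -> c.1 != 0).
  by move=> /choice[cf H]; exists cf.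
move=> Z; have [fZ|nfZ] := pselect (pcells f Z); last by exists [::].
have [_ [m [a [b [a0 ->]]]]] := pcells_polytope fZ.
have E i x : affv ((a i)^T, b i) x = dotv (a i) x - b i.
  rewrite /affv /= mxE; congr (_ - _); apply: eq_bigr => l _.
  by rewrite mxE mulrC.
exists [seq ((a i)^T, b i) | i <- enum 'I_m] => _; split.
  move=> x /=; split=> [H c /mapP[i _ ->]|H i]; first by rewrite E subr_lt0.
  by rewrite -subr_lt0 -E; apply: H; apply: map_f; rewrite mem_enum.
move=> c /mapP[i _ ->] /=; apply: contraNneq (a0 i) => /(congr1 trmx).
by rewrite trmxK trmx0 => ->.
Qed.

Fixpoint icell (s : seq (set 'rV[R]_d)) : set 'rV[R]_d :=
  if s is Z :: s' then [set x | Z x /\ icell s' (paff_fun f x)] else setT.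

Lemma icell_codom n (s : 'I_n -> set 'rV[R]_d) :
  [set x | forall k : 'I_n, s k (iter k (paff_fun f) x)] = icell (codom s).
Proof.
elim: n s => [|n IH] s.
  rewrite /codom /image_mem enum_ord0 /=; apply/seteqP; split=> // x _ [] //.
rewrite /codom /image_mem enum_ordSl /= -map_comp -[map _ _]/(codom (s \o lift ord0)) -IH.
apply/seteqP; split=> x /=.
  move=> H; split; first exact: (H ord0).
  by move=> k; have := H (lift ord0 k); rewrite lift0 iterSr.
move=> [H0 H] k; case: (unliftP ord0 k) => [j ->|->//].
by rewrite lift0 iterSr; apply: H.
Qed.

Context (cf : set 'rV[R]_d -> seq ('cV[R]_d * R)) (cells : seq (set 'rV[R]_d)).
Hypothesis cfP : forall Z, pcells f Z ->
  (forall x, Z x <-> forall c, c \in cf Z -> affv c x < 0) /\ (forall c, c \in cf Z -> c.1 != 0).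
Hypothesis cellsP : pcells f = [set` cells].

Let cellE Z : Z \in cells -> pcells f Z.
Proof. by rewrite cellsP. Qed.

Lemma pcells_eq Z Z' x : pcells f Z -> pcells f Z' -> Z x -> Z' x -> Z = Z'.
Proof. by move=> fZ fZ' Zx Z'x; apply: (pcells_disjoint fZ fZ'); exists x. Qed.

Lemma icellE s : all [in cells] s ->
  forall x, icell s x <-> forall c, c \in iforms cf (plin f) (ptrans f) s -> affv c x < 0.
Proof.
elim: s => [|Z s IH] /=; first by [].
move=> /andP[/cellE fZ sc] x; split.
  move=> [Zx sx] c; rewrite mem_cat => /orP[|/mapP[c' c's ->]].
    exact: (((cfP fZ).1 x).1 Zx).
  by rewrite affv_pull -(paff_fun_affine fZ Zx); apply: ((IH sc _).1 sx).
move=> H; have Zx : Z x by apply/((cfP fZ).1 x) => c cZ; apply: H; rewrite mem_cat cZ.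
split=> //; rewrite (paff_fun_affine fZ Zx); apply/(IH sc) => c cs.
by rewrite -affv_pull; apply: H; rewrite mem_cat map_f ?orbT.
Qed.

Lemma icell_orbit s x : all [in cells] s -> icell s x ->
  iter_domain f (size s) x /\ dpaffn f (size s) x = ilin (plin f) s.
Proof.
elim: s x => [|Z s IH] x /=; first by move=> _ _; split=> //; rewrite /dpaffn big_ord0.
move=> /andP[/cellE fZ sc] [Zx /(IH _ sc)[sD sE]]; split.
  move=> [|k] ks; first by exists Z.
  by rewrite iterSr; apply: sD.
rewrite /dpaffn big_ord_recl /=; congr (_ *m _); last first.
  rewrite -sE /dpaffn; apply: eq_bigr => k _; by rewrite add0n -iterS iterSr.
rewrite /dpaff; congr (plin f _); rewrite /cell_at.
case: xgetP => [Z' -> [fZ' Z'x]|/(_ Z)[]//].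
exact: pcells_eq fZ' fZ Z'x Zx.
Qed.

Lemma adm_orbit s : adm cells cf (plin f) (ptrans f) s ->
  exists2 x, iter_domain f (size s) x & dpaffn f (size s) x = ilin (plin f) s.
Proof.
move=> [sc [x /(icellE sc) sx]]; exists x; by have [] := icell_orbit sc sx.
Qed.

Lemma affv_continuous (c : 'cV[R]_d * R) : continuous (affv c).
Proof.
have -> : affv c = (fun x => (- c.2) - (x *m (- c.1)) 0 0).
  have Nm (M : 'M[R]_1) : (- M) 0 0 = - M 0 0 by rewrite mxE.
  by apply/funext => x; rewrite /affv mulmxN Nm opprK addrC.
by apply: continuous_subl; exact: form_continuous.
Qed.

(** Strict inequalities become weak on the closure, which is all that adjacency to a flag of length
    0 requires. *)
Lemma closure_icell_adj s a G : all [in cells] s -> closure (icell s) a ->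
  adj 0 (iforms cf (plin f) (ptrans f) s) a G.
Proof.
move=> sc ca c cs; split=> //.
have cl : closed [set x | affv c x <= 0].
  rewrite -[X in closed X]/(affv c @^-1` [set x | x <= 0]).
  apply: closed_comp; last exact: closed_le.
  by move=> x _; exact: affv_continuous.
have : closure [set x | affv c x <= 0] a.
  by apply: closure_subset ca => x /(icellE sc)/(_ c cs)/ltW.
by rewrite -(closure_id _).1.
Qed.

Lemma partition_icell n W : continuity_partition f n W -> exists2 s,
  W = icell s & size s = n /\ adm cells cf (plin f) (ptrans f) s.
Proof.
move=> [[x Wx] [s [fs WE]]]; exists (codom s); first by rewrite WE icell_codom.
have sc : all [in cells] (codom s).
  by apply/allP => _ /codomP[k ->]; have := fs k; rewrite cellsP.
split; first by rewrite size_codom card_ord.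
by split=> //; exists x; apply/(icellE sc); rewrite -icell_codom -WE.
Qed.

Lemma mult_at_le (K : R) n a :
  covered (adj_itin cells cf (plin f) (ptrans f) n 0 a 1%:M) K -> (mult_at f n a)%:R <= K.
Proof.
move=> [ss ssK H]; apply: le_trans ssK; rewrite ler_nat.
have sub : [set Z | continuity_partition f n Z /\ closure Z a] `<=` [set` map icell ss].
  move=> W [/partition_icell[s -> [sn sadm]] ca] /=; apply: map_f; apply: H.
  by split=> //; apply: closure_icell_adj => //; case: sadm.
have fin : finite_set [set Z | continuity_partition f n Z /\ closure Z a].
  by apply: sub_finite_set sub _; apply/finite_seqP; exists (map icell ss).
rewrite -(size_map icell) /mult_at; apply: leq_trans (size_undup _).
rewrite -card_fseq; apply: fsubset_leq_card; apply/fsubsetP => W.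
by rewrite in_fset_set// !inE => /sub.
Qed.

Lemma rho_minors (e : R) m : (rho f m <= e%:E)%E -> forall eps, 0 < eps ->
  exists n0, forall n x k v, (n0 <= n)%N -> iter_domain f n x -> (k <= m)%N -> sphere v ->
    (angular_norm k (dpaffn f n x) v <= (expR (n%:R * (e + eps)))%:E)%E.
Proof.
move=> re eps e0; have : (rho f m < (e + eps)%:E)%E.
  by apply: le_lt_trans re _; rewrite lte_fin ltrDl.
(* The shift makes [n] positive, so that the factor [1 / n] can be cleared. *)
move=> /limn_esup_lt_near[n0 H]; exists n0.+1 => n x k v nn xD km vS.
have n0' : 0 < n%:R :> R by rewrite ltr0n (leq_trans _ nn).
have := H n (ltnW nn); rewrite lee_pdivrMl// -EFinM => Hn.
apply: lne_le_inv; apply: le_trans Hn.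
apply: le_trans (ereal_sup_ubound _); last by exists x.
have B := @le_bigmax_seq _ _ _ (index_iota 0 m.+1) -oo%E k xpredT
  (fun k => ereal_sup [set lne (angular_norm k (dpaffn f n x) v) | v in sphere]).
apply: (le_trans _ (B _ _)); rewrite ?mem_index_iota//.
by apply: ereal_sup_ubound; exists v.
Qed.

(** The exterior power of order 0 has norm at least 1. The hypotheses keep the suprema from being
    taken over empty sets, where they would be [-oo]. *)
Lemma rho_ge0 m : (0 < d)%N -> (forall n, iter_domain f n !=set0) -> (0 <= rho f m)%E.
Proof.
move=> d0 ne; apply: limf_esup_ge0.
  by move=> [N _ /(_ N)]; apply; rewrite /= leqnn.
move=> n; rewrite mule_ge0 ?lee_fin ?invr_ge0//.
have [x xD] := ne n.
apply: le_trans (ereal_sup_ubound _); last by exists x.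
have B := @le_bigmax_seq _ _ _ (index_iota 0 m.+1) -oo%E 0%N xpredT
  (fun k => ereal_sup [set lne (angular_norm k (dpaffn f n x) v) | v in sphere]).
apply: (le_trans _ (B _ _)); rewrite ?mem_index_iota//.
apply: le_trans (ereal_sup_ubound _); last first.
  exists (delta_mx 0 (Ordinal d0)); last by [].
  by rewrite /sphere /= /enorm dotv_delta eqxx sqrtr1.
by rewrite lne_ge0 angular_norm0_ge1.
Qed.

(** All later partitions are empty, so the multiplicity is at most 0 and its [lne] is [-oo]. *)
Lemma Hmult_empty n0 : iter_domain f n0 = set0 -> Hmult f = -oo%E.
Proof.
move=> E; apply/eqP; rewrite -leeNy_eq; apply: (@limn_esup_le_near _ _ _ n0.+1) => n nn.
have pn : continuity_partition f n = set0.
  rewrite -subset0 => W [[x Wx] [s [fs WE]]].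
  have : iter_domain f n0 x.
    move=> k kn0; have kn : (k < n)%N by apply: leq_trans kn0 (ltnW nn).
    move: Wx; rewrite WE => /(_ (Ordinal kn)) H; by exists (s (Ordinal kn)).
  by rewrite E.
have m0 : (mult f n <= 0)%E.
  apply: ge_ereal_sup => _ [a _ <-]; rewrite /mult_at pn.
  rewrite (_ : [set Z | _] = set0) ?fset_set0 ?cardfs0//.
  by rewrite -subset0 => Z [].
by rewrite le0_lneNy// mulrNy gtr0_sg ?mul1e// invr_gt0 ltr0n (leq_trans _ nn).
Qed.

Lemma Hmult_le (h : R) : growth cells cf (plin f) (ptrans f) 0 h -> (Hmult f <= h%:E)%E.
Proof.
move=> gh; apply/lee_addgt0Pr => eps e0.
have e2 : 0 < eps / 2 by rewrite divr_gt0.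
have [C C0 HC] := gh _ e2.
have C1 : 0 < 1 + C by rewrite ltr_pwDl.
(* From this time on [ln (1 + C) <= n * (eps / 2)]; [1 + C] guards against [C = 0]. *)
pose n0 := (Num.truncn (ln (1 + C) / (eps / 2))).+1.
apply: (@limn_esup_le_near _ _ _ n0) => n nn.
have n0' : 0 < n%:R :> R by rewrite ltr0n (leq_trans _ nn).
rewrite lee_pdivrMl// -EFinD -EFinM; apply: lne_le.
apply: (@le_trans _ _ ((1 + C) * expR (n%:R * (h + eps / 2)))%:E).
  apply: ge_ereal_sup => _ [a _ <-]; rewrite lee_fin.
  apply: mult_at_le; apply: coveredW (HC n a 1%:M _) => //.
    by rewrite ler_pM2r ?expR_gt0// lerDr.
  by rewrite /orthomx trmx1 mulmx1.
rewrite lee_fin -{1}(lnK C1) -expRD ler_expR.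
have /andP[_ /ltW l1] := truncn_itv (ltW (divr_gt0 ltr01 e2)).
have ln0 : 0 <= ln (1 + C) / (eps / 2) by rewrite divr_ge0 ?(ltW e2)// ln_ge0// lerDl.
have /andP[_ /ltW l2] := truncn_itv ln0.
have : ln (1 + C) / (eps / 2) <= n%:R by apply: le_trans l2 _; rewrite ler_nat.
by rewrite ler_pdivrMr// => H; rewrite [eps in leRHS]splitr; lra.
Qed.

(** The induction variable [m] counts the directions removed from a full flag. Going from [m] to
    [m + 1] adds [e m], except that the first removal is free. Real majorants [e] replace the
    extended reals [rho f i]. *)
Lemma growth_le (e : nat -> R) : paff_nondegenerate f ->
  (forall i, (1 <= i < d)%N -> 0 <= e i /\ (rho f i <= (e i)%:E)%E) ->
  growth cells cf (plin f) (ptrans f) 0 (\sum_(1 <= i < d) e i).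
Proof.
move=> nd He.
have unit Z : Z \in cells -> plin f Z \in unitmx by move=> /cellE/nd.
suff H m : (m <= d)%N -> growth cells cf (plin f) (ptrans f) (d - m) (\sum_(1 <= i < m) e i).
  by have := H d (leqnn d); rewrite subnn.
elim: m => [_|m IH md].
  rewrite subn0 big_geq//; apply: growth_full => //.
    by move=> Z c /cellE fZ; apply: (cfP fZ).2.
  move=> Z Z' x /cellE fZ /cellE fZ' /(cfP fZ).1 Zx /(cfP fZ').1 Z'x.
  exact: pcells_eq fZ fZ' Zx Z'x.
have id' : (d - m.+1 < d)%N by lia.
pose i : 'I_d := Ordinal id'.
have iE : (d.-1 - i)%N = m by rewrite /=; lia.
have h0 : 0 <= \sum_(1 <= i < m) e i.
  by rewrite big_nat; apply: sumr_ge0 => l /andP[l1 lm]; apply: (He l _).1; lia.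
have {}IH : growth cells cf (plin f) (ptrans f) i.+1 (\sum_(1 <= i < m) e i).
  by have := IH (ltnW md); rewrite (_ : i.+1 = d - m)%N//=; lia.
(* For [i = d - 1] nothing lies beyond the index: only minors of order 0 occur, and the rate does
   not grow. Hence the sum starts at 1. *)
case: m => [|m] in md id' i iE h0 IH *.
  rewrite big_geq//; rewrite big_geq// in h0 IH.
  rewrite -[X in growth _ _ _ _ _ X]addr0.
  apply: (growth_step unit (i := i)) => // eps e0; exists 1, 0%N; split=> //.
  move=> n s T G G' _ _ _ _ _ _ _ k I J; rewrite iE leqn0 => /eqP k0; subst k.
  move=> _ _; rewrite det_mx00 normr1 mul1r add0r -[leLHS]expR0 ler_expR.
  by rewrite mulr_ge0// ltW.
have [em0 em] := He m.+1 md.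
rewrite big_nat_recr//=.
apply: (growth_step unit (i := i)) => // eps e0.
have [n0 Hn0] := rho_minors em e0.
(* The constant of [flag_minor_le], summed over [k] to serve all orders at once. *)
pose M k : R := #|{: incidx k d}|%:R * k`!%:R * (1 + #|{: incidx k d}|%:R * k`!%:R ^+ 2).
have M0 k : 0 <= M k by rewrite !mulr_ge0// addr_ge0// mulr_ge0// exprn_ge0.
exists (\sum_(k < m.+2) M k), n0; split; first by apply: sumr_ge0 => k _.
move=> n s T G G' nn sn sadm oG oG' lT GA k I J; rewrite iE => km iI iJ.
have [x xD xE] := adm_orbit sadm; rewrite sn in xD xE.
rewrite -xE in GA.
have Hb v : sphere v -> (angular_norm k (dpaffn f n x) v <=
    (expR (n%:R * (e m.+1 + eps)))%:E)%E.
  by move=> vS; apply: Hn0.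
apply: le_trans (flag_minor_le oG oG' lT GA iI iJ Hb) _.
rewrite ler_pM2r ?expR_gt0// -/(M k).
have km' : (k < m.+2)%N by [].
by rewrite (bigD1 (Ordinal km'))//= lerDl sumr_ge0.
Qed.

End PiecewiseAffine.

Theorem theorem2 (R : realType) (d : nat) (X : set 'rV[R]_d) (f : paff X) :
  paff_nondegenerate f -> (Hmult f <= \sum_(1 <= i < d) rho f i)%E.
Proof.
move=> nd.
have [ne|] := pselect (forall n, iter_domain f n !=set0); last first.
  by move=> /existsNP[n /set0P/negP/negPn/eqP/Hmult_empty ->]; rewrite leNye.
have rho0 i : (1 <= i < d)%N -> (0 <= rho f i)%E.
  by move=> /andP[_ id]; apply: rho_ge0 => //; apply: leq_ltn_trans id.
(* One infinite rate makes the sum infinite, no term being [-oo]; otherwise all rates are real. *)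
have [[i [id ri]]|fin] := pselect (exists i, (1 <= i < d)%N /\ rho f i = +oo%E).
  rewrite big_nat (_ : \sum_(_ <= _ < _ | _) _ = +oo)%E ?leey//.
  apply/esum_eqyP => [j /rho0|]; first by case: (rho f j).
  by exists i; rewrite mem_index_iota.
have rhoE i : (1 <= i < d)%N -> rho f i = (fine (rho f i))%:E.
  move=> id; rewrite fineK//; have := rho0 i id.
  case E : (rho f i) => // _; by case: fin; exists i.
rewrite (eq_big_nat _ _ rhoE) sumEFin.
have [cf cfP] := paff_constraints f.
have [cells cellsP] := (finite_seqP _).1 (pcells_finite f).
apply: (Hmult_le cfP cellsP); apply: (growth_le cfP cellsP nd) => i id.
by split; [apply: fine_ge0; exact: rho0|rewrite -rhoE].
Qed.
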